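(* Let $\mathcal{H}$ be a Krein space, $W\in L(\mathcal{H})^{[s]}$ and let $\mathcal{S}$ be a closed subspace of $\mathcal{H}$. Suppose that $W$ is $\mathcal{S}$-weakly complementable and $J$ is a signature operator. Then $$W_{/[\mathcal{S}]}^{J}=W_{/[\mathcal{S}]}^{J_\alpha}$$ for any other signature operator $J_\alpha$; i.e., the Schur complement does not depend on the fundamental decomposition of $\mathcal{H}$.
   Context: Hilbert spaces are complex and separable. A Krein space $(\mathcal{H},[\,\cdot,\cdot\,])$ is a linear space with a sesquilinear Hermitian form admitting a fundamental decomposition $\mathcal{H}=\mathcal{H}_+[\dotplus]\mathcal{H}_-$, an $[\,\cdot,\cdot\,]$-orthogonal direct sum in which $(\mathcal{H}_+,[\,\cdot,\cdot\,])$ and $(\mathcal{H}_-,-[\,\cdot,\cdot\,])$ are Hilbert spaces. The associated signature operator is $J=P_+-P_-$, where $P_\pm$ is the projection onto $\mathcal{H}_\pm$ with nullspace $\mathcal{H}_\mp$; it yields the Hilbert space inner product $\langle x,y\rangle=[Jx,y]$. All Hilbert norms arising this way are equivalent; $L(\mathcal{H})$ is the set of operators bounded for them. $T^{\#}$ denotes the Krein space adjoint, $[Tx,y]=[x,T^{\#}y]$, and $L(\mathcal{H})^{[s]}=\{T\in L(\mathcal{H}):T=T^{\#}\}$. If $W\in L(\mathcal{H})^{[s]}$ then $JW$ is selfadjoint in $(\mathcal{H},\langle\cdot,\cdot\rangle)$. Hilbert space notions: let $B$ be a bounded selfadjoint operator on a Hilbert space with block form $B=\begin{pmatrix} a & b\\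 b^* & c\end{pmatrix}$ with respect to $\mathcal{S}\oplus\mathcal{S}^\perp$. $B$ is $\mathcal{S}$-weakly complementable if $R(b)\subseteq R(|a|^{1/2})$. In that case let $f$ be the reduced solution of $b=|a|^{1/2}x$, i.e. the unique bounded $f:\mathcal{S}^\perp\to\mathcal{S}$ with $b=|a|^{1/2}f$, $N(f)=N(b)$, $R(f)\subseteq\overline{R(|a|^{1/2})}$, and let $a=u|a|$ be the polar decomposition ($N(u)=N(a)$). The Schur complement is $B_{/\mathcal{S}}:=\begin{pmatrix}0&0\\0&c-f^*uf\end{pmatrix}$. ($R$, $N$ denote range and nullspace.) Krein space notions: $W$ is $\mathcal{S}$-weakly complementable if, for some signature operator $J$, $JW$ is $\mathcal{S}$-weakly complementable in the Hilbert space associated with $J$; this property does not depend on the choice of $J$. In that case, for each signature operator $J$, the Schur complement of $W$ to $\mathcal{S}$ corresponding to $J$ is $W_{/[\mathcal{S}]}^{J}:=J\,(JW)_{/\mathcal{S}}$, the Hilbert space Schur complement being computed in the Hilbert space associated with $J$. *)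

(* Defs.v *)
From HB Require Import structures.
From mathcomp Require Import all_boot all_order all_algebra.
From mathcomp Require Import complex ring.
From mathcomp Require Import all_classical all_reals all_analysis.

Set Implicit Arguments.
Unset Strict Implicit.
Unset Printing Implicit Defensive.

Import Order.TTheory GRing.Theory Num.Theory Num.Def.
Import numFieldNormedType.Exports.

Local Open Scope classical_set_scope.
Local Open Scope complex_scope.
Local Open Scope ring_scope.

Section DotOf.
Variables (R : realType) (U : lmodType R[i]) (f : U -> U -> R[i]).
Hypothesis f_linear : forall a x y z, f (a *: x + y) z = a * f x z + f y z.
Hypothesis f_herm : forall x y, f x y = conjC (f y x).
Hypothesis f_gt0 : forall x, x != 0 -> 0 < f x x.

Let f_bilinear : bilinear_for
  (GRing.Scale.Law.clone _ _ *%R _)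
  (GRing.Scale.Law.clone _ _ (@conjC R[i] \; *%R) _) f.
Proof.
split=> [z a x y|z a x y]; first exact: f_linear.
by rewrite f_herm f_linear rmorphD rmorphM/= -!f_herm.
Qed.

Let f_hermitian x y : f x y = (-1) ^+ false * conjC (f y x).
Proof. by rewrite expr0 mul1r. Qed.

Definition dot_of : {dot U for (@conjC R[i])} :=
  HB.pack f (bilinear_isBilinear.Build _ _ _ _ _ _ f f_bilinear)
    (isHermitianSesquilinear.Build _ _ _ _ f f_hermitian)
    (isDotProduct.Build _ _ f f_gt0).

End DotOf.

(* Complex inner product spaces: normed modules over R[i] whose norm comes
   from an inner product, linear in its first argument. *)

HB.mixin Record NormedModule_isInner (R : realType) (V : Type)
    & NormedModule R[i] V := {
  inner : {dot V for (@conjC R[i])} ;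
  normr_inner : forall x : V, `|x| = sqrtC (inner x x)
}.

#[short(type="innerType")]
HB.structure Definition Inner (R : realType) :=
  {V of NormedModule_isInner R V & NormedModule R[i] V}.

(* [inner_of ip] is the space U with the norm and topology of the inner
   product ip; distinct inner products on U give distinct aliases. *)
Definition inner_of (R : realType) (U : lmodType R[i])
  (ip : {dot U for (@conjC R[i])}) : Type := U.

Section InnerOf.
Variables (R : realType) (U : lmodType R[i]).
Variable (ip : {dot U for (@conjC R[i])}).

Let nrm (x : U) : R[i] := sqrtC (ip x x).

Let nrm_ge0 x : 0 <= nrm x. Proof. exact: sqrt_dnorm_ge0. Qed.

Let nrmK x : nrm x ^+ 2 = ip x x. Proof. exact: sqrtCK. Qed.

Lemma dot_cauchy_schwarz (x y : U) :
  `|ip x y| ^+ 2 <= ip x x * ip y y.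
Proof.
have [->|y0] := eqVneq y 0.
  by rewrite !linear0r normr0 expr0n.
have yy0 : 0 < ip y y by rewrite dnorm_gt0.
pose z := ip y y *: x - ip x y *: y.
have : 0 <= ip z z by exact: dnorm_ge0.
have hyx : ip y x = Num.conj (ip x y) by rewrite hermC expr0 mul1r.
have yyR : Num.conj (ip y y) = ip y y by rewrite geC0_conj// ltW.
have -> : ip z z = ip y y * (ip x x * ip y y - `|ip x y| ^+ 2).
  set r := RHS; rewrite /z linearBl !linearBr !linearZl_LR !linearZr_LR /=.
  by rewrite hyx yyR {}/r normCK /GRing.scale/=; ring.
by rewrite pmulr_rge0// subr_ge0.
Qed.

Let ler_nrmD x y : nrm (x + y) <= nrm x + nrm y.
Proof.
rewrite -(@ler_pXn2r _ 2)// ?nnegrE ?addr_ge0//.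
rewrite nrmK dnormD sqrrD !nrmK -addrA -[X in _ <= X]addrA lerD2l addrC lerD2r.
have xy : `|ip x y| <= nrm x * nrm y.
  rewrite -(@ler_pXn2r _ 2)// ?nnegrE ?mulr_ge0//.
  by rewrite exprMn !nrmK dot_cauchy_schwarz.
apply: le_trans (_ : `|ip x y| *+ 2 <= _); last by rewrite lerMn2r.
have h : ip x y + Num.conj (ip x y) \is Num.real.
  by rewrite CrealE rmorphD/= conjCK addrC.
apply: le_trans (real_ler_norm h) _.
by apply: le_trans (ler_normD _ _) _; rewrite norm_conjC mulr2n.
Qed.

Let nrmZ l x : nrm (l *: x) = `|l| * nrm x.
Proof. by rewrite /nrm dnormZ rootCMl ?exprn_ge0// sqrCK. Qed.

Let nrm0_eq0 x : nrm x = 0 -> x = 0.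
Proof. by move=> /eqP; rewrite sqrt_dnorm_eq0 => /eqP. Qed.

HB.instance Definition _ := GRing.Lmodule.copy (inner_of ip) U.
HB.instance Definition _ := Lmodule_isNormed.Build R[i] (inner_of ip)
  ler_nrmD nrmZ nrm0_eq0.


Let ipD a (x y z : inner_of ip) : ip (a *: x + y) z = a * ip x z + ip y z.
Proof. exact: linearPl. Qed.

Let ipC (x y : inner_of ip) : ip x y = conjC (ip y x).
Proof. by rewrite hermC expr0 mul1r. Qed.

Let ip_gt0 (x : inner_of ip) : x != 0 -> 0 < ip x x.
Proof. by rewrite -(dnorm_gt0 ip). Qed.

HB.instance Definition _ := @NormedModule_isInner.Build R (inner_of ip)
  (dot_of ipD ipC ip_gt0) (fun=> erefl).

End InnerOf.

(* The type of elements of a linear subspace S, itself a vector space. *)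
Section Subspace.
Variables (R : realType) (V : lmodType R[i]) (S : submodClosed V).

Record lin_subspace := Subspace { subval :> V ; _ : subval \in S }.

HB.instance Definition _ := [isSub of lin_subspace for subval].
HB.instance Definition _ := [Choice of lin_subspace by <:].
HB.instance Definition _ := [SubChoice_isSubLmodule of lin_subspace by <:].

End Subspace.

(* When the ambient space has an inner product, so does every subspace. *)
Section SubspaceInner.
Variables (R : realType) (E : innerType R) (S : submodClosed E).

Let nrm (x : lin_subspace S) : R[i] := `|subval x|.

Let ler_nrmD x y : nrm (x + y) <= nrm x + nrm y.
Proof. exact: ler_normD. Qed.

Let nrmZ l x : nrm (l *: x) = `|l| * nrm x.
Proof. exact: normrZ. Qed.

Let nrm0_eq0 x : nrm x = 0 -> x = 0.
Proof. by move=> /normr0_eq0 ?; exact: val_inj. Qed.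

HB.instance Definition _ := Lmodule_isNormed.Build R[i] (lin_subspace S)
  ler_nrmD nrmZ nrm0_eq0.

Let ip (x y : lin_subspace S) : R[i] := inner (subval x) (subval y).

Let ipD a x y z : ip (a *: x + y) z = a * ip x z + ip y z.
Proof. exact: linearPl. Qed.

Let ipC x y : ip x y = conjC (ip y x).
Proof. by rewrite /ip hermC expr0 mul1r. Qed.

Let ip_gt0 x : x != 0 -> 0 < ip x x.
Proof. by rewrite /ip dnorm_gt0. Qed.

HB.instance Definition _ := @NormedModule_isInner.Build R (lin_subspace S)
  (dot_of ipD ipC ip_gt0) (fun x => normr_inner (subval x)).

Definition orth_compl : {pred E} :=
  [pred x | `[< forall y, y \in S -> inner x y = 0 >]].

Let orth_compl_submod : submod_closed orth_compl.
Proof.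
split=> [|a x y /asboolP hx /asboolP hy].
  by apply/asboolP => y _; rewrite linear0l.
by apply/asboolP => z zS; rewrite linearPl/= hx// hy// mulr0 addr0.
Qed.

HB.instance Definition _ :=
  GRing.isSubmodClosed.Build R[i] E orth_compl orth_compl_submod.

Definition orth_proj (x : E) : lin_subspace S :=
  xget 0 [set s : lin_subspace S | forall t : lin_subspace S,
                                 inner (x - subval s) (subval t) = 0].

End SubspaceInner.

Arguments orth_compl {R E} S.
Arguments orth_proj {R E} S x.

(* Operators on complex inner product spaces. The objects below that are
   characterised by existence and uniqueness on Hilbert spaces (adjoint,
   square root, polar factor, reduced solution) are picked by [xget], with a
   junk value when no such object exists. *)
Section Operators.
Variable R : realType.

Definition nullspace (E F : innerType R) (T : E -> F) : set E := T @^-1` [set 0].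

Definition bounded_operator (E F : innerType R) (T : E -> F) : Prop :=
  linear T /\ exists M : R, forall x, `|T x| <= M%:C * `|x|.

Definition adjoint (E F : innerType R) (T : E -> F) : F -> E :=
  xget (fun=> 0)
    [set T' : F -> E | forall x y, inner (T x) y = inner x (T' y)].

Definition positive_operator (E : innerType R) (T : E -> E) : Prop :=
  bounded_operator T /\ forall x, 0 <= inner (T x) x.

Definition sqrt_operator (E : innerType R) (T : E -> E) : E -> E :=
  xget (fun=> 0) [set Q : E -> E | positive_operator Q /\ Q \o Q = T].

Definition abs_operator (E : innerType R) (T : E -> E) : E -> E :=
  sqrt_operator (adjoint T \o T).

Definition partial_isometry (E F : innerType R) (u : E -> F) : Prop :=
  bounded_operator u /\
  forall x, (forall y, nullspace u y -> inner x y = 0) -> `|u x| = `|x|.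

Definition polar_factor (E : innerType R) (T : E -> E) : E -> E :=
  xget (fun=> 0)
    [set u : E -> E | [/\ partial_isometry u, T = u \o abs_operator T &
                          nullspace u = nullspace T]].

Definition reduced_solution (E F : innerType R) (A : F -> F) (b : E -> F) :
    E -> F :=
  xget (fun=> 0)
    [set f : E -> F | [/\ bounded_operator f, b = A \o f,
                          nullspace f = nullspace b &
                          range f `<=` closure (range A)]].

(* The block of B mapping the subspace T into the subspace S. *)
Definition block (E : innerType R) (S T : submodClosed E) (B : E -> E) :
    lin_subspace T -> lin_subspace S :=
  fun t => orth_proj S (B (subval t)).

End Operators.

Arguments block {R E} S T B.

Section SchurComplement.
Variables (R : realType) (E : innerType R) (S : submodClosed E) (B : E -> E).

Let a : lin_subspace S -> lin_subspace S := block S S B.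
Let b : lin_subspace (orth_compl S) -> lin_subspace S := block S (orth_compl S) B.
Let c : lin_subspace (orth_compl S) -> lin_subspace (orth_compl S) :=
  block (orth_compl S) (orth_compl S) B.

Let sqrt_abs_a : lin_subspace S -> lin_subspace S := sqrt_operator (abs_operator a).

Definition weakly_complementable : Prop := range b `<=` range sqrt_abs_a.

Definition schur_complement : E -> E :=
  let f := reduced_solution sqrt_abs_a b in
  let u := polar_factor a in
  fun x => let y := orth_proj (orth_compl S) x in
           subval (c y - adjoint f (u (f y))).

End SchurComplement.

(* [f] makes U a separable Hilbert space. *)
Definition is_hilbert (R : realType) (U : lmodType R[i]) (f : U -> U -> R[i]) :
    Prop :=
  exists ip : {dot U for (@conjC R[i])},
    [/\ forall x y, f x y = ip x y,
        forall F : set_system (inner_of ip),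
          ProperFilter F -> cauchy F -> cvg F &
        exists D : set (inner_of ip), countable D /\ dense D].

Section Krein.
Variables (R : realType) (H : lmodType R[i]).
Variable form : {hermitian H for false & (@conjC R[i])}.

Record fundamental_decomposition := FundamentalDecomposition {
  fd_pos : submodClosed H;
  fd_neg : submodClosed H;
  fd_sum : forall x, exists2 p, p \in fd_pos & x - p \in fd_neg;
  fd_direct : forall x, x \in fd_pos -> x \in fd_neg -> x = 0;
  fd_orth : forall x y, x \in fd_pos -> y \in fd_neg -> form x y = 0;
  fd_pos_hilbert :
    is_hilbert (fun x y : lin_subspace fd_pos => form (subval x) (subval y));
  fd_neg_hilbert :
    is_hilbert (fun x y : lin_subspace fd_neg => - form (subval x) (subval y))
}.

Definition is_krein : Prop := inhabited fundamental_decomposition.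

(* The projection onto A with nullspace B. *)
Definition proj_along (A B : submodClosed H) (x : H) : H :=
  xget 0 [set p | p \in A /\ x - p \in B].

Section Signature.
Variable D : fundamental_decomposition.

Definition signature_operator (x : H) : H :=
  proj_along (fd_pos D) (fd_neg D) x - proj_along (fd_neg D) (fd_pos D) x.

Let J := signature_operator.

Let rpB (A : submodClosed H) (x y : H) : x \in A -> y \in A -> x - y \in A.
Proof. by move=> xA yA; rewrite -scaleN1r rpredD ?rpredZ. Qed.

Let proj_alongE (A B : submodClosed H) (x y : H) :
    (forall z, z \in A -> z \in B -> z = 0) ->
  x \in A -> y \in B -> proj_along A B (x + y) = x.
Proof.
move=> AB0 xA yB; apply: xget_unique => [|q [/= qA qB]].
  by rewrite /= addrC addKr.
apply/eqP; rewrite -subr_eq0; apply/eqP/AB0; first exact: rpB.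
suff -> : (q : H) - x = y - (x + y - q) by exact: rpB.
by rewrite opprB [x + y]addrC opprD addrCA addNKr.
Qed.

Let JE p n : p \in fd_pos D -> n \in fd_neg D -> J (p + n) = p - n.
Proof.
move=> pP nN; rewrite /J /signature_operator; congr (_ - _).
  by apply: proj_alongE => //; exact: fd_direct.
rewrite addrC; apply: proj_alongE => // z zN zP; exact: fd_direct zP zN.
Qed.

Let splitD x : exists p n, [/\ p \in fd_pos D, n \in fd_neg D & x = p + n].
Proof.
have [p pP nN] := fd_sum D x; exists p, (x - p).
by split=> //; rewrite addrC subrK.
Qed.

Let form_neg x y : x \in fd_neg D -> y \in fd_pos D -> form x y = 0.
Proof.
by move=> xN yP; rewrite hermC (fd_orth yP xN) rmorph0 mulr0.
Qed.

Let J_linear a x y : J (a *: x + y) = a *: J x + J y.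
Proof.
have [p [n [pP nN ->]]] := splitD x; have [q [m [qP mN ->]]] := splitD y.
rewrite scalerDr addrACA !JE ?rpredD ?rpredZ//.
by rewrite scalerBr opprD addrACA.
Qed.

Let jform x y := form (J x) y.

Let jform_linear a x y z : jform (a *: x + y) z = a * jform x z + jform y z.
Proof. by rewrite /jform J_linear linearPl. Qed.

Let jform_herm x y : jform x y = conjC (jform y x).
Proof.
have [p [n [pP nN ->]]] := splitD x; have [q [m [qP mN ->]]] := splitD y.
rewrite /jform !JE// !linearBl !linearDr /=.
rewrite (fd_orth pP mN) (form_neg nN qP) (fd_orth qP nN) (form_neg mN pP).
by rewrite !(addr0, add0r, rmorphB) /= [form p q]hermC [form n m]hermC !mul1r.
Qed.

Let jform_gt0 x : x != 0 -> 0 < jform x x.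
Proof.
have [p [n [pP nN ->]]] := splitD x => pn0.
rewrite /jform JE// linearBl !linearDr /= (fd_orth pP nN) (form_neg nN pP).
rewrite addr0 add0r.
have [ip [ipE _ _]] := fd_pos_hilbert D.
have [im [imE _ _]] := fd_neg_hilbert D.
have pE := ipE (Subspace pP) (Subspace pP); have nE := imE (Subspace nN) (Subspace nN).
rewrite /= in pE nE; rewrite pE nE.
have [p0|p0] := eqVneq p 0; last first.
  rewrite ltr_pwDl ?dnorm_ge0// dnorm_gt0.
  by apply: contra p0 => /eqP/(congr1 val)/= ->.
rewrite ltr_wpDl ?dnorm_ge0// dnorm_gt0.
by apply: contra pn0 => /eqP/(congr1 val)/= ->; rewrite p0 addr0.
Qed.

(* <x, y> = [J x, y] *)
Definition signature_dot : {dot H for (@conjC R[i])} :=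
  dot_of jform_linear jform_herm jform_gt0.

(* H with the Hilbert space structure associated with J. *)
Definition hilbert_of : innerType R := inner_of signature_dot.

End Signature.

Definition krein_closed (S : submodClosed H) : Prop :=
  forall D, closed [set x : hilbert_of D | x \in S].

Definition krein_bounded (W : H -> H) : Prop :=
  forall D, bounded_operator (W : hilbert_of D -> hilbert_of D).

Definition krein_selfadjoint (W : H -> H) : Prop :=
  forall x y, form (W x) y = form x (W y).

Section KreinSchur.
Variables (W : H -> H) (S : submodClosed H).

Definition krein_weakly_complementable : Prop :=
  exists D, @weakly_complementable R (hilbert_of D) S (signature_operator D \o W).

Definition krein_schur_complement (D : fundamental_decomposition) : H -> H :=
  signature_operator D \o
    @schur_complement R (hilbert_of D) S (signature_operator D \o W).

End KreinSchur.
End Krein.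

(* Main.v *)
Require Import Defs.
From mathcomp Require Import all_boot all_order all_algebra.
From mathcomp Require Import complex ring lra zify.
From mathcomp Require Import all_classical all_reals all_analysis.

(* Write w(x, y) = [W x, y], a form that does not involve J, and let p_J(s) be
   the norm of |a|^(1/2) s on S, where a is the compression of J W to S.  The
   proof approximates the Schur complement by w.  If t in S is chosen so that
   |a|^(1/2) t is close to u f x, then w(x - t, s) is small compared with
   p_J(s) for s in S, while w(x - t, y) is close to [W^J_/S x, y], and p_J(t)
   stays bounded.  Taking such a t for (x, J) and such a t' for (y, J'), the
   number w(x - t, y - t') is close both to [W^J_/S x, y] and to the conjugate
   of [W^J'_/S y, x], provided p_J and p_J' are equivalent on S.

   Equivalence of the p_J is the statement that norm B x <= c norm A x for
   nonnegative A, B implies <B x, x> <= C <A x, x>, with constants that survive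
   a change to an equivalent inner product.  Weak complementability amounts to
   norm (J W s) <= C p_J(s) on S, so it passes from one J to all others.

   Every identity and estimate only involves real parts of inner products, so
   the spaces are treated as real inner product spaces with complex-linear
   operators. *)

Set Implicit Arguments.
Unset Strict Implicit.
Unset Printing Implicit Defensive.

Import Order.TTheory GRing.Theory Num.Theory Num.Def.
Import numFieldNormedType.Exports.

Local Open Scope classical_set_scope.
Local Open Scope complex_scope.
Local Open Scope ring_scope.

(** * Real inner product and norm limits *)

Section RealInner.
Variables (R : realType) (E : innerType R).
Implicit Types (x y z : E) (r : R).

Definition rd x y : R := complex.Re (inner x y).

(** The norm of the structure takes values in [R[i]]; this copy takes values in the ordered field
    [R]. *)
Definition nm x : R := Num.sqrt (rd x x).

Lemma complexRe_conj (z : R[i]) : complex.Re (conjC z) = complex.Re z.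
Proof. by case: z. Qed.

Lemma ReM_real r (z : R[i]) : complex.Re (r%:C * z) = r * complex.Re z.
Proof. by case: z => a b /=; rewrite mul0r subr0. Qed.

Lemma rdC x y : rd x y = rd y x.
Proof. by rewrite /rd hermC expr0 mul1r complexRe_conj. Qed.

Lemma rdDl x y z : rd (x + y) z = rd x z + rd y z.
Proof. by rewrite /rd linearDl raddfD. Qed.

Lemma rdNl x z : rd (- x) z = - rd x z.
Proof. by rewrite /rd linearNl raddfN. Qed.

Lemma rd0l z : rd 0 z = 0.
Proof. by rewrite /rd linear0l. Qed.

Lemma rdZl r x z : rd (r%:C *: x) z = r * rd x z.
Proof. by rewrite /rd linearZl_LR -ReM_real. Qed.

Lemma rdDr x y z : rd x (y + z) = rd x y + rd x z.
Proof. by rewrite !(rdC x) rdDl. Qed.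

Lemma rdNr x z : rd x (- z) = - rd x z.
Proof. by rewrite !(rdC x) rdNl. Qed.

Lemma rd0r z : rd z 0 = 0.
Proof. by rewrite rdC rd0l. Qed.

Lemma rdZr r x z : rd x (r%:C *: z) = r * rd x z.
Proof. by rewrite !(rdC x) rdZl. Qed.

Definition rdE := (rdDl, rdDr, rdNl, rdNr, rdZl, rdZr).

Lemma inner_rd x : inner x x = (rd x x)%:C.
Proof.
have := dnorm_ge0 inner x; rewrite lecE /= => /andP[/eqP i0 _].
by rewrite /rd; case: (inner x x) i0 => a b /= ->.
Qed.

Lemma rd_ge0 x : 0 <= rd x x.
Proof. by rewrite -ler0c -inner_rd dnorm_ge0. Qed.

Lemma rd_eq0 x : rd x x = 0 -> x = 0.
Proof.
by move=> x0; apply/eqP; rewrite -(dnorm_eq0 inner) inner_rd x0.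
Qed.

Lemma nm_ge0 x : 0 <= nm x. Proof. exact: sqrtr_ge0. Qed.

Lemma nm_sqr x : nm x ^+ 2 = rd x x.
Proof. by rewrite sqr_sqrtr ?rd_ge0. Qed.

Lemma norm_nm x : `|x| = (nm x)%:C.
Proof.
rewrite normr_inner inner_rd -nm_sqr.
by rewrite rmorphXn /= sqrCK// ler0c nm_ge0.
Qed.

Lemma nm0 : nm (0 : E) = 0.
Proof. by rewrite /nm rd0l sqrtr0. Qed.

Lemma nm_eq0 x : nm x = 0 -> x = 0.
Proof. by move=> x0; apply: rd_eq0; rewrite -nm_sqr x0 expr0n. Qed.

Lemma nmN x : nm (- x) = nm x.
Proof. by rewrite /nm rdNl rdNr opprK. Qed.

Lemma nmB x y : nm (x - y) = nm (y - x).
Proof. by rewrite -nmN opprB. Qed.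

Lemma nmZ r x : nm (r%:C *: x) = `|r| * nm x.
Proof.
rewrite /nm rdZl rdZr mulrA -expr2 sqrtrM ?sqr_ge0// sqrtr_sqr.
by [].
Qed.

Lemma rd_cs x y : rd x y <= nm x * nm y.
Proof.
have [->|y0] := eqVneq y 0; first by rewrite rd0r mulr_ge0 ?nm_ge0.
have yy : 0 < rd y y.
  rewrite lt_neqAle rd_ge0 andbT eq_sym; apply: contra_neq y0; exact: rd_eq0.
pose z := x - (rd x y / rd y y)%:C *: y.
have h : 0 <= rd z z * rd y y.
  by rewrite mulr_ge0 ?rd_ge0// ltW.
have {}h : rd x y ^+ 2 <= rd x x * rd y y.
  rewrite -subr_ge0.
  suff -> : rd x x * rd y y - rd x y ^+ 2 = rd z z * rd y y by [].
  by rewrite /z !rdE [rd y x]rdC; field; rewrite gt_eqF.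
rewrite -!nm_sqr -exprMn in h.
apply: le_trans (ler_norm _) _.
by rewrite -(@ler_pXn2r _ 2)// ?nnegrE ?mulr_ge0 ?nm_ge0// real_normK ?num_real.
Qed.

Lemma rd_cs_norm x y : `|rd x y| <= nm x * nm y.
Proof.
by rewrite ler_norml rd_cs andbT lerNl -rdNl (le_trans (rd_cs _ _))// nmN.
Qed.

Lemma nmD x y : nm (x + y) <= nm x + nm y.
Proof.
rewrite -(@ler_pXn2r _ 2)// ?nnegrE ?addr_ge0 ?nm_ge0//.
rewrite nm_sqr !rdE sqrrD !nm_sqr [rd y x]rdC.
have := rd_cs x y; lra.
Qed.

Lemma nmBD x y z : nm (x - z) <= nm (x - y) + nm (y - z).
Proof. by have := nmD (x - y) (y - z); rewrite addrA subrK. Qed.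

Lemma rd_ext x y : (forall z, rd x z = rd y z) -> x = y.
Proof.
move=> h; apply/eqP; rewrite -subr_eq0; apply/eqP/rd_eq0.
by rewrite rdDl rdNl h subrr.
Qed.

(** Cancels a factor [nm x]. It bounds a vector known only through its inner products, by testing it
    against itself. *)
Lemma nm_le_rd x c : 0 <= c -> rd x x <= c * nm x -> nm x <= c.
Proof.
move=> c0; rewrite -nm_sqr expr2.
have [->//|] := eqVneq (nm x) 0.
move=> x0; rewrite ler_pM2r// lt_neqAle nm_ge0 eq_sym x0//.
Qed.

End RealInner.

(* The real part determines the inner product, by linearity in ['i *: x]. *)
Lemma inner_rd_ext (R : realType) (E F : innerType R) (x y : E) (u v : F) :
  rd x y = rd u v -> rd ('i%C *: x) y = rd ('i%C *: u) v ->
  inner x y = inner u v.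
Proof.
rewrite /rd !linearZl_LR /=.
case: (inner x y) (inner u v) => a b [c d] /= -> h.
by congr (_ +i* _); move: h; rewrite !mul0r !mul1r !sub0r => /oppr_inj.
Qed.

(** * Sequential limits and closures in the real norm *)

Section Limits.
Variables (R : realType) (E : innerType R).
Implicit Types (x y z l : E) (r : R) (u : nat -> E).

Definition nm_lim u l :=
  forall e, 0 < e -> exists N, forall n, (N <= n)%N -> nm (u n - l) < e.

Definition nm_cauchy u :=
  forall e, 0 < e -> exists N, forall m n, (N <= m)%N -> (N <= n)%N ->
    nm (u m - u n) < e.

Definition nm_complete := forall u, nm_cauchy u -> exists l, nm_lim u l.

Definition in_closure (A : set E) l :=
  forall e, 0 < e -> exists2 x, A x & nm (l - x) < e.

Lemma small_eq0 r c : 0 <= r -> (forall e, 0 < e -> r <= c * e) -> r = 0.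
Proof.
move=> r0 h; apply/eqP; rewrite eq_le r0 andbT leNgt; apply/negP => rp.
pose e := r / (2 * (`|c| + 1)).
have c1 : 0 < `|c| + 1 by rewrite ltr_wpDl.
have e0 : 0 < e by rewrite /e divr_gt0// mulr_gt0.
have : r <= (`|c| + 1) * e.
  apply: le_trans (h _ e0) _; rewrite ler_pM2r//.
  by apply: le_trans (ler_norm _) _; rewrite lerDl.
rewrite /e; have -> : (`|c| + 1) * (r / (2 * (`|c| + 1))) = r / 2.
  by field; rewrite gt_eqF.
lra.
Qed.

Lemma le_of_small a b c : (forall e, 0 < e -> a <= b + c * e) -> a <= b :> R.
Proof.
move=> h; rewrite leNgt; apply/negP => ab.
suff : a - b = 0 by lra.
apply: (@small_eq0 _ c); first lra.
by move=> e /h; lra.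
Qed.

Lemma inv_nat_small e : 0 < e -> exists N, forall n, (N <= n)%N -> n.+1%:R^-1 < e :> R.
Proof.
move=> e0; exists (Num.truncn e^-1) => n Nn.
rewrite invf_plt ?posrE//; apply: lt_le_trans (_ : (Num.truncn e^-1).+1%:R <= _).
  exact: truncnS_gt.
by rewrite ler_nat.
Qed.

Lemma nm_lim_uniq u l l' : nm_lim u l -> nm_lim u l' -> l = l'.
Proof.
move=> h h'; apply/eqP; rewrite -subr_eq0; apply/eqP/nm_eq0.
apply: (@small_eq0 _ 2); first exact: nm_ge0.
move=> e e0; have [N hN] := h e e0; have [N' hN'] := h' e e0.
have := hN (maxn N N') (leq_maxl _ _); have := hN' (maxn N N') (leq_maxr _ _).
have := nmBD l (u (maxn N N')) l'; rewrite (nmB l (u _)); lra.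
Qed.

Lemma nm_lim_closure (A : set E) u l :
  nm_lim u l -> (forall n, A (u n)) -> in_closure A l.
Proof.
move=> h uA e /h[N /(_ N (leqnn _)) hN]; exists (u N) => //.
by rewrite nmB.
Qed.

Lemma in_closure_seq (A : set E) l : in_closure A l ->
  exists2 u, nm_lim u l & forall n, A (u n).
Proof.
move=> h; have h' n : exists x, A x /\ nm (l - x) < n.+1%:R^-1.
  by have [|x] := h n.+1%:R^-1; [rewrite invr_gt0|exists x].
have [u hu] := choice h'; exists u => [e|n]; last by have [] := hu n.
move=> /inv_nat_small[N hN]; exists N => n /hN; rewrite nmB.
by apply: lt_trans; have [] := hu n.
Qed.

End Limits.

(** * Riesz representation and uniform boundedness *)

Section LinearMaps.
Variables (K : pzRingType) (U V : lmodType K) (T : U -> V).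
Hypothesis T_linear : linear T.

Lemma linD x y : T (x + y) = T x + T y.
Proof. by rewrite -{1}[x]scale1r T_linear scale1r. Qed.

Lemma lin0 : T 0 = 0.
Proof. by apply: (addrI (T 0)); rewrite -linD !addr0. Qed.

Lemma linZ a x : T (a *: x) = a *: T x.
Proof. by rewrite -[a *: x]addr0 T_linear lin0 addr0. Qed.

Lemma linN x : T (- x) = - T x.
Proof. by rewrite -scaleN1r linZ scaleN1r. Qed.

Lemma linB x y : T (x - y) = T x - T y.
Proof. by rewrite linD linN. Qed.

End LinearMaps.

Lemma linear_comp (K : pzRingType) (U V W : lmodType K) (T : U -> V) (T' : V -> W) :
  linear T -> linear T' -> linear (fun x => T' (T x)).
Proof. by move=> h h' a x y; rewrite h h'. Qed.

Lemma linear_add (K : comPzRingType) (U V : lmodType K) (T T' : U -> V) :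
  linear T -> linear T' -> linear (fun x => T x + T' x).
Proof. by move=> h h' a x y; rewrite h h' scalerDr addrACA. Qed.

Lemma linear_opp (K : comPzRingType) (U V : lmodType K) (T : U -> V) :
  linear T -> linear (fun x => - T x).
Proof. by move=> h a x y; rewrite h opprD scalerN. Qed.

Lemma linear_scale (K : comPzRingType) (U V : lmodType K) (c : K) (T : U -> V) :
  linear T -> linear (fun x => c *: T x).
Proof. by move=> h a x y; rewrite h scalerDr !scalerA mulrC. Qed.

Lemma le_of_unit_ball (R : realType) (V : lmodType R[i]) (N N' : V -> R) C :
  (forall r x, N (r%:C *: x) = `|r| * N x) ->
  (forall r x, N' (r%:C *: x) = `|r| * N' x) -> (forall x, 0 <= N' x) ->
  (forall x, N' x <= 1 -> N x <= C) -> forall x, N x <= C * N' x.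
Proof.
move=> NZ N'Z N'0 NC x; apply: (@le_of_small _ _ _ C) => e e0.
(* [N'] may vanish at [x], hence the scaling by [N' x + e] instead of [N' x]. *)
have Nx : 0 < N' x + e by rewrite ltr_wpDl.
rewrite -mulrDr -ler_pdivrMr// mulrC.
have := NC ((N' x + e)^-1%:C *: x); rewrite NZ N'Z gtr0_norm ?invr_gt0//; apply.
by rewrite mulrC ler_pdivrMr// mul1r lerDl ltW.
Qed.

Section Riesz.
Variables (R : realType) (E : innerType R) (G : lmodType R[i]).
Variables (T : G -> E) (phi : G -> R).
Hypothesis E_complete : nm_complete E.
Hypothesis T_linear : linear T.
Hypothesis phiD : forall x y, phi (x + y) = phi x + phi y.
Hypothesis phiZ : forall r x, phi (r%:C *: x) = r * phi x.

(* Minimise [‖T s‖² - 2 phi s]: minimising sequences are Cauchy by the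
   parallelogram law. *)
Lemma riesz c : (forall s, phi s <= c * nm (T s)) ->
  exists2 g, in_closure (range T) g & forall s, phi s = rd (T s) g.
Proof.
move=> phi_le.
pose q s := rd (T s) (T s) - 2 * phi s.
have qge s : - c ^+ 2 <= q s.
  rewrite /q -nm_sqr; have := phi_le s; have := sqr_ge0 (nm (T s) - c).
  rewrite sqrrB; lra.
pose A := range q.
have A0 : A !=set0 by exists (q 0), 0.
have Alb : has_lbound A by exists (- c ^+ 2) => _ [s _ <-].
pose m := inf A.
have mq s : m <= q s by apply: ge_inf => //; exists s.
have near n : exists s, q s < m + n.+1%:R^-1.
  have [||_ [s _ <-] ?] := @inf_adherent R A n.+1%:R^-1; last by exists s.
    by rewrite invr_gt0.
  by [].
have [s hs] := choice near.
have Ts_cauchy : nm_cauchy (T \o s).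
  move=> e e0; have [|N hN] := @inv_nat_small _ (e ^+ 2 / 4).
    by rewrite divr_gt0// exprn_gt0.
  exists N => i j /hN hi /hN hj.
  rewrite -(@ltr_pXn2r _ 2)// ?nnegrE ?nm_ge0 1?ltW// nm_sqr /=.
  have := mq ((2^-1)%:C *: (s i + s j)); have := hs i; have := hs j.
  move: (i.+1%:R^-1) (j.+1%:R^-1) hi hj => di dj hi hj.
  rewrite /q phiZ phiD (linZ T_linear) (linD T_linear) !rdE [rd (T (s j)) (T (s i))]rdC. lra.
have [g hg] := E_complete Ts_cauchy.
exists g; first by apply: nm_lim_closure hg _ => n; exists (s n).
move=> t.
have key r : 0 <= 2 * r * (rd (T t) g - phi t) + r ^+ 2 * rd (T t) (T t).
  apply: (@le_of_small _ _ _ (1 + 2 * `|r| * nm (T t))) => e e0.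
  have [N hN] := hg e e0; have [N' hN'] := inv_nat_small e0.
  pose n := maxn N N'.
  have h1 := hN n (leq_maxl _ _); have h2 := hN' n (leq_maxr _ _).
  have := mq (s n + r%:C *: t); have := hs n.
  move: (n.+1%:R^-1) h2 => dn h2.
  rewrite /q phiD phiZ (linD T_linear) (linZ T_linear) !rdE [rd (T (s n)) (T t)]rdC => h3 h4.
  have h5 : r * rd (T t) (T (s n)) <= r * rd (T t) g + `|r| * nm (T t) * e.
    rewrite -lerBlDl -mulrBr -rdNr -rdDr -mulrA.
    apply: le_trans (ler_norm _) _; rewrite normrM ler_wpM2l//.
    apply: le_trans (rd_cs_norm _ _) _; rewrite ler_wpM2l ?nm_ge0//.
    exact: ltW.
  lra.
set d := rd (T t) g - phi t in key *; set N := rd _ _ in key.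
suff : d = 0 by rewrite /d; lra.
have N0 : 0 <= N by exact: rd_ge0.
(* A near-optimal [r], defined even when [T t = 0]; it turns the expression into a negative multiple
   of [d ^+ 2]. *)
have := key (- d / (N + 1)).
have -> : 2 * (- d / (N + 1)) * d + (- d / (N + 1)) ^+ 2 * N =
  - d ^+ 2 * ((N + 2) / (N + 1) ^+ 2) by field; rewrite gt_eqF// ltr_wpDl.
rewrite mulNr oppr_ge0 pmulr_lle0; last by rewrite divr_gt0 ?exprn_gt0 ?ltr_wpDl.
by move=> h; apply/eqP; rewrite -sqrf_eq0 eq_le h sqr_ge0.
Qed.

End Riesz.

Section UniformBoundedness.
Variables (R : realType) (E : innerType R) (V : set E).
Hypothesis E_complete : nm_complete E.
Hypothesis V_pointwise : forall x, exists M, forall v, V v -> rd x v <= M.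

(** The steps that follow the one of length [d n] have total length at most [d n / 2], so they undo
    at most half of its effect. *)
Let d (n : nat) : R := (3 ^+ n)^-1.

Let d_gt0 n : 0 < d n. Proof. by rewrite invr_gt0 exprn_gt0. Qed.

Let dS n : d n.+1 = d n / 3.
Proof. by rewrite /d exprS invfM mulrC. Qed.

Let d_small n : d n <= n.+1%:R^-1.
Proof.
rewrite lef_pV2 ?posrE ?exprn_gt0// -natrX ler_nat.
by elim: n => // n IH; rewrite expnS; apply: leq_trans (_ : 3 * n.+1 <= _)%N; lia.
Qed.

(* Gliding hump: [step n x] moves by [3^-(n+1)] along [v n], in the direction
   that does not decrease the modulus of the product with [v n]. *)
Lemma uniform_boundedness : exists C, forall v, V v -> nm v <= C.
Proof.
apply: contrapT => noC.
have big n : exists v, V v /\ n.+1%:R / d n.+1 < nm v.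
  apply: contrapT => nov; apply: noC; exists (n.+1%:R / d n.+1) => v Vv.
  by rewrite leNgt; apply/negP => h; apply: nov; exists v.
have [v hv] := choice big.
have v0 n : 0 < nm (v n).
  by apply: le_lt_trans (hv n).2; rewrite divr_ge0// ltW.
pose sg (r : R) : R := if 0 <= r then 1 else -1.
have sg1 r : `|sg r| = 1 by rewrite /sg; case: ifP; rewrite ?normrN normr1.
have sgM r : sg r * r = `|r|.
  rewrite /sg; case: ifPn => [/ger0_norm ->|]; first by rewrite mul1r.
  by rewrite -ltNge mulN1r => /ltr0_norm.
pose step n x : E := x + (sg (rd x (v n)) * d n.+1 / nm (v n))%:C *: v n.
pose x := fix x n : E := if n is m.+1 then step m (x m) else 0.
have xS n : nm (x n.+1 - x n) = d n.+1.
  rewrite /= /step addrC addKr nmZ !normrM normfV sg1 mul1r.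
  rewrite !ger0_norm ?nm_ge0 ?ltW// ?invr_gt0//.
  by rewrite divfK ?gt_eqF.
have xv n : d n.+1 * nm (v n) <= `|rd (x n.+1) (v n)|.
  have -> : rd (x n.+1) (v n) =
      sg (rd (x n) (v n)) * (`|rd (x n) (v n)| + d n.+1 * nm (v n)).
    rewrite /= -/(x n) /step rdDl rdZl -(nm_sqr (v n)); move: (rd _ _) => r.
    have {1}-> : r = sg r * `|r|.
      by rewrite -sgM mulrA -expr2 -real_normK ?num_real// sg1 expr1n mul1r.
    by field; rewrite gt_eqF.
  have dv : 0 <= d n.+1 * nm (v n) by rewrite mulr_ge0 ?ltW.
  by rewrite normrM sg1 mul1r ger0_norm ?addr_ge0// lerDr.
have xD n k : nm (x (n + k)%N - x n) <= (d n - d (n + k)%N) / 2.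
  elim: k => [|k IH]; first by rewrite addn0 !subrr nm0 mul0r.
  rewrite addnS; apply: le_trans (nmBD _ (x (n + k)%N) _) _.
  rewrite xS; have := d_gt0 (n + k)%N; rewrite dS; lra.
have xdist n m : (n <= m)%N -> nm (x m - x n) <= d n / 2.
  by move=> /subnKC <-; apply: le_trans (xD _ _) _; have := d_gt0 (n + (m - n))%N; lra.
have [|l hl] := E_complete (u := x).
  move=> e e0; have [N hN] := inv_nat_small e0; exists N => m n /xdist hm /xdist hn.
  apply: le_lt_trans (nmBD _ (x N) _) _; rewrite (nmB (x N)).
  have := d_small N; have := hN N (leqnn _); have := d_gt0 N.
  by move: (d N) (N.+1%:R^-1) hm hn => dN rN *; lra.
have xl n : nm (x n - l) <= d n / 2.
  apply: (@le_of_small _ _ _ 1) => e /hl[N hN].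
  have := hN (maxn n N) (leq_maxr _ _); have := xdist n (maxn n N) (leq_maxl _ _).
  have := nmBD (x n) (x (maxn n N)) l; rewrite (nmB (x n) (x _)); lra.
have [M hM] := V_pointwise l; have [M' hM'] := V_pointwise (- l).
(* The hump leaves [|rd l (v n)|] at least [d n.+1 * nm (v n) / 2], which exceeds [n.+1 / 2]; hence
   the factor 2. *)
pose n := Num.truncn (2 * (`|M| + `|M'|)).
have nM : 2 * (`|M| + `|M'|) < n.+1%:R by exact: truncnS_gt.
have [Vv] := hv n; rewrite ltr_pdivrMr// mulrC => hn.
have lM : `|rd l (v n)| <= `|M| + `|M'|.
  have := hM _ Vv; have := hM' _ Vv; rewrite rdNl.
  have := ler_norm M; have := ler_norm M'; have := normr_ge0 M; have := normr_ge0 M'.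
  by rewrite ler_norml => *; apply/andP; split; lra.
have := xv n; have := rd_cs_norm (x n.+1 - l) (v n); rewrite rdDl rdNl.
have : nm (x n.+1 - l) * nm (v n) <= d n.+1 / 2 * nm (v n).
  by rewrite ler_wpM2r ?nm_ge0.
have := ler_normD (rd (x n.+1) (v n) - rd l (v n)) (rd l (v n)); rewrite subrK.
lra.
Qed.

End UniformBoundedness.

(** * Bounded, symmetric and nonnegative operators *)

Section NmLimits.
Variables (R : realType) (E F : innerType R).

Definition nm_bounded (T : E -> F) := exists M, forall x, nm (T x) <= M * nm x.

Lemma nm_boundedP (T : E -> F) : nm_bounded T ->
  exists2 M, 0 < M & forall x, nm (T x) <= M * nm x.
Proof.
move=> [M hM]; exists (`|M| + 1); first by rewrite ltr_wpDl.
move=> x; apply: le_trans (hM x) _; rewrite ler_wpM2r ?nm_ge0//.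
by apply: le_trans (ler_norm _) _; rewrite lerDl.
Qed.

Lemma bounded_operatorE (T : E -> F) :
  bounded_operator T <-> linear T /\ nm_bounded T.
Proof.
split=> -[lT [M hM]]; split=> //; exists M => x; have := hM x.
  by rewrite !norm_nm -rmorphM /= lecR.
by rewrite !norm_nm -rmorphM /= lecR.
Qed.

Lemma nm_lim_op (T : E -> F) u l : linear T -> nm_bounded T ->
  nm_lim u l -> nm_lim (T \o u) (T l).
Proof.
move=> lT /nm_boundedP[M M0 hM] ul e e0; have [|N hN] := ul (e / M).
  exact: divr_gt0.
exists N => n /hN h; rewrite /= -(linB lT); apply: le_lt_trans (hM _) _.
by rewrite mulrC -ltr_pdivlMr.
Qed.

Lemma nm_limD u l u' l' : nm_lim u l -> nm_lim u' l' ->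
  nm_lim (fun n => u n + u' n : E) (l + l').
Proof.
move=> h h' e e0; have [|N hN] := h (e / 2); first lra.
have [|N' hN'] := h' (e / 2); first lra.
exists (maxn N N') => n; rewrite geq_max => /andP[/hN a /hN' b].
by rewrite opprD addrACA; have := nmD (u n - l) (u' n - l'); lra.
Qed.

Lemma nm_lim_cst (l : E) : nm_lim (fun=> l) l.
Proof. by move=> e e0; exists 0 => n _; rewrite subrr nm0. Qed.

Lemma nm_lim_shift (u : nat -> E) l : nm_lim u l -> nm_lim (fun n => u n.+1) l.
Proof. by move=> h e /h[N hN]; exists N => n Nn; apply: hN; exact: leqW. Qed.

Lemma nm_lim_eq (u v : nat -> E) l : u =1 v -> nm_lim u l -> nm_lim v l.
Proof. by move=> /funext ->. Qed.

Lemma rd_lim (u : nat -> E) l (v : nat -> F) k x y :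
  nm_lim u l -> nm_lim v k -> (forall n, rd (u n) x = rd (v n) y) ->
  rd l x = rd k y.
Proof.
move=> ul vk uv; apply/eqP; rewrite -subr_eq0 -normr_eq0; apply/eqP.
apply: (@small_eq0 _ _ (nm x + nm y)) => [|e e0]; first exact: normr_ge0.
have [N hN] := ul e e0; have [N' hN'] := vk e e0.
set n := maxn N N'; have h := hN n (leq_maxl _ _); have h' := hN' n (leq_maxr _ _).
have -> : rd l x - rd k y = rd (v n - k) y - rd (u n - l) x.
  by rewrite !rdDl !rdNl uv; ring.
apply: le_trans (ler_normB _ _) _; rewrite addrC mulrDl; apply: lerD.
  by apply: le_trans (rd_cs_norm _ _) _; rewrite mulrC ler_wpM2l ?nm_ge0// ltW.
by apply: le_trans (rd_cs_norm _ _) _; rewrite mulrC ler_wpM2l ?nm_ge0// ltW.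
Qed.

End NmLimits.

Lemma nm_bounded_scale (R : realType) (E : innerType R) (a : R[i]) :
  nm_bounded (fun x : E => a *: x).
Proof.
exists (complex.Re `|a|) => x.
rewrite -lecR rmorphM /= -!norm_nm normrZ.
exact: lexx.
Qed.

Lemma linear_scaler (K : comPzRingType) (U : lmodType K) (a : K) :
  linear (fun x : U => a *: x).
Proof. by move=> c x y; rewrite scalerDr !scalerA mulrC. Qed.

Section Symmetric.
Variables (R : realType) (E : innerType R).
Implicit Types (x y : E) (T : E -> E).

Definition symmetric_op T := forall x y, rd (T x) y = rd x (T y).

Definition nonneg_op T := forall x, 0 <= rd (T x) x.

Lemma quadratic_ge0 (a b c : R) : 0 <= c ->
  (forall r, 0 <= a + 2 * r * b + r ^+ 2 * c) -> b ^+ 2 <= a * c.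
Proof.
move=> c0 h; have [c00|cn0] := eqVneq c 0.
  have [->|b0] := eqVneq b 0; first by rewrite c00 mulr0 expr0n.
  (* With [c = 0] the polynomial is affine in [r] and equals -1 at this point. *)
  have := h (- (a + 1) / (2 * b)); rewrite c00 mulr0 addr0.
  have -> : 2 * (- (a + 1) / (2 * b)) * b = - (a + 1) by field.
  lra.
have := h (- b / c).
have -> : a + 2 * (- b / c) * b + (- b / c) ^+ 2 * c = (a * c - b ^+ 2) / c by field.
by rewrite pmulr_lge0 ?subr_ge0// invr_gt0 lt_neqAle eq_sym cn0.
Qed.

Lemma nonneg_cs T x y : linear T -> symmetric_op T -> nonneg_op T ->
  rd (T x) y ^+ 2 <= rd (T x) x * rd (T y) y.
Proof.
move=> lT sT pT; apply: quadratic_ge0 (pT y) _ => r.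
have := pT (x + r%:C *: y); rewrite (linD lT) (linZ lT) !rdE.
by rewrite [rd (T y) x]sT [rd y (T x)]rdC; lra.
Qed.

(** Over complex scalars nonnegativity forces symmetry: the imaginary part of [<T z, z>] vanishes at
    [z = x + i y], which equates the real parts of [<T x, y>] and [<T y, x>]. Conversely, symmetry
    makes [<T x, x>] real. *)
Lemma positive_operatorE T : positive_operator T <->
  [/\ linear T, nm_bounded T, symmetric_op T & nonneg_op T].
Proof.
rewrite /positive_operator bounded_operatorE; split.
  move=> [[lT bT] pT].
  have im x : complex.Im (inner (T x) x) = 0 by exact: ger0_Im.
  split=> //; last by move=> x; have := pT x; rewrite lecE => /andP[].
  move=> x y; have := im (x + 'i%C *: y).
  rewrite (linD lT) (linZ lT) !linearDl !linearDr /= !linearZl_LR !linearZr_LR /=.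
  rewrite (rdC x) /rd; have := im x; have := im y.
  case: (inner (T x) x) => a1 b1; case: (inner (T x) y) => a2 b2.
  case: (inner (T y) x) => a3 b3; case: (inner (T y) y) => a4 b4 /=.
  lra.
move=> [lT bT sT pT]; split; first by split.
move=> x; rewrite lecE /= pT andbT.
have : rd ('i%C *: T x) x = rd (T x) ('i%C *: x) by rewrite -(linZ lT) sT rdC.
rewrite /rd linearZl_LR linearZr_LR /=.
by case: (inner (T x) x) => a b /= h; apply/eqP; lra.
Qed.

End Symmetric.

(** * Square roots, Douglas factorisation, polar decomposition *)

Section SquareRootSeries.
Variables (R : realType) (E : innerType R) (X : E -> E).
Hypothesis E_complete : nm_complete E.
Hypothesis X_linear : linear X.
Hypothesis X_symmetric : symmetric_op X.
Hypothesis X_contract : forall x, nm (X x) <= nm x.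

(* The iteration [2 Y = X + Y ^ 2] solves [(1 - Y) ^ 2 = 1 - X]; its scalar
   version [y] with [X] replaced by [1] dominates it. *)
Fixpoint sqrt_iter n : E -> E :=
  if n is m.+1 then fun x => (2^-1)%:C *: (X x + sqrt_iter m (sqrt_iter m x))
  else fun=> 0.

Fixpoint sqrt_majorant n : R :=
  if n is m.+1 then (1 + sqrt_majorant m ^+ 2) / 2 else 0.

Local Notation Y := sqrt_iter.
Local Notation y := sqrt_majorant.

Let y_bound n : 0 <= y n <= 1.
Proof.
elim: n => [|n /andP[h0 h1]]; first by rewrite /= lexx ler01.
rewrite /=; have := sqr_ge0 (y n); have : y n ^+ 2 <= 1 by rewrite expr_le1.
by move=> *; apply/andP; split; lra.
Qed.

Let y_ge0 n : 0 <= y n. Proof. by have /andP[] := y_bound n. Qed.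
Let y_le1 n : y n <= 1. Proof. by have /andP[] := y_bound n. Qed.

Let Y_linear n : linear (Y n).
Proof.
elim: n => [|n IH] a u v; first by rewrite scaler0 addr0.
rewrite /= X_linear !IH addrACA -scalerDr [LHS]scalerDr !scalerA.
by rewrite [(2^-1)%:C * a]mulrC.
Qed.

Let Y_symmetric n : symmetric_op (Y n).
Proof.
elim: n => [|n IH] u v; first by rewrite rd0l rd0r.
by rewrite /= !rdE X_symmetric !IH.
Qed.

Let Y_bound n x : nm (Y n x) <= y n * nm x.
Proof.
elim: n x => [|n IH] x; first by rewrite nm0 mul0r.
rewrite /= nmZ ger0_norm ?invr_ge0//.
have := nmD (X x) (Y n (Y n x)); have := X_contract x.
have := IH (Y n x); have := ler_wpM2l (y_ge0 n) (IH x).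
rewrite mulrA -expr2; lra.
Qed.

Let Y_contract n x : nm (Y n x) <= nm x.
Proof.
by apply: le_trans (Y_bound n x) _; rewrite ler_piMl ?nm_ge0.
Qed.

Let Y_step n x : nm (Y n.+1 x - Y n x) <= (y n.+1 - y n) * nm x.
Proof.
elim: n x => [|n IH] x.
  by rewrite !subr0; exact: Y_bound 1%N x.
(* Half a difference of squares, split without commuting the iterates; the bounds of the two terms
   add up to the step of the majorant. *)
have -> : Y n.+2 x - Y n.+1 x =
    (2^-1)%:C *: ((Y n.+1 (Y n.+1 x) - Y n (Y n.+1 x)) + Y n (Y n.+1 x - Y n x)).
  rewrite (linB (Y_linear n)) addrA subrK.
  rewrite [in LHS]/= -/(Y n.+1) -scalerBr opprD addrACA subrr add0r.
  by [].
rewrite nmZ ger0_norm ?invr_ge0//.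
have := nmD (Y n.+1 (Y n.+1 x) - Y n (Y n.+1 x)) (Y n (Y n.+1 x - Y n x)).
have := IH (Y n.+1 x); have := Y_bound n (Y n.+1 x - Y n x).
have d0 : 0 <= y n.+1 - y n.
  by rewrite /=; have := sqr_ge0 (1 - y n); rewrite sqrrB; lra.
have := ler_wpM2l d0 (Y_bound n.+1 x); have := ler_wpM2l (y_ge0 n) (IH x).
have -> : y n.+2 - y n.+1 = 2^-1 * ((y n.+1 - y n) * (y n.+1 + y n)).
  by rewrite [y n.+2]/= -/(y n.+1) [X in _ - X]/=; field.
move: (y n.+1) (y n) (nm x) (nm _) => a b c *; nra.
Qed.

Let y_le n m : (n <= m)%N -> y n <= y m.
Proof.
move=> /subnKC <-; elim: (m - n)%N => [|k IH]; first by rewrite addn0.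
rewrite addnS; apply: le_trans IH _ => /=.
by have := sqr_ge0 (1 - y (n + k)); rewrite sqrrB; lra.
Qed.

Let Y_dist n m x : (n <= m)%N -> nm (Y m x - Y n x) <= (y m - y n) * nm x.
Proof.
move=> /subnKC <-; elim: (m - n)%N => [|k IH].
  by rewrite addn0 !subrr nm0 mul0r.
rewrite addnS; apply: le_trans (nmBD _ (Y (n + k)%N x) _) _.
have := Y_step (n + k) x; lra.
Qed.

(** [y] is bounded by 1, and some [y N] lies within [e] of its supremum. *)
Let y_cauchy e : 0 < e -> exists N, forall n, (N <= n)%N -> y n - y N < e.
Proof.
move=> e0.
have supy : has_sup (range y).
  by split; [exists (y 0), 0|exists 1 => _ [n _ <-]].
have [_ [N _ <-] hN] := sup_adherent e0 supy; exists N => n _.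
have : y n <= sup (range y) by apply: ub_le_sup; [case: supy|exists n].
lra.
Qed.

Let Y_cvg x : exists l, nm_lim (fun n => Y n x) l.
Proof.
apply: E_complete => e e0.
have c0 : 0 < nm x + 1 by rewrite ltr_wpDl ?nm_ge0.
have [|N hN] := @y_cauchy (e / (2 * (nm x + 1))); first by rewrite divr_gt0// mulr_gt0.
have half m : (N <= m)%N -> nm (Y m x - Y N x) < e / 2.
  move=> Nm; apply: le_lt_trans (Y_dist x Nm) _.
  apply: le_lt_trans (_ : (y m - y N) * (nm x + 1) < _).
    by rewrite ler_wpM2l ?lerDl// subr_ge0 y_le.
  rewrite -ltr_pdivlMr//; apply: lt_le_trans (hN _ Nm) _.
  by rewrite invfM mulrA.
exists N => m n /half hm /half hn.
by have := nmBD (Y m x) (Y N x) (Y n x); rewrite (nmB (Y N x) (Y n x)); lra.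
Qed.

(** [Q = 1 - L] for the limit [L] of the iterates, since [2 L = X + L ^ 2]. The commutation clause
    passes from the iterates to the limit; it later yields uniqueness of the root. *)
Lemma sqrt_one_sub : exists Q : E -> E,
  [/\ positive_operator Q, forall x, Q (Q x) = x - X x &
      forall Z, linear Z -> nm_bounded Z -> (forall x, Z (X x) = X (Z x)) ->
        forall x, Z (Q x) = Q (Z x)].
Proof.
have [L hL] := choice Y_cvg.
have L_linear : linear L.
  move=> a u v; apply: nm_lim_uniq (hL _) _.
  have h := nm_limD (nm_lim_op (@linear_scaler _ E a) (nm_bounded_scale E a) (hL u)) (hL v).
  by apply: nm_lim_eq h => n; rewrite /= Y_linear.
have L_symm : symmetric_op L.
  move=> u v; rewrite [RHS]rdC; apply: rd_lim (hL u) (hL v) _ => n.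
  by rewrite Y_symmetric rdC.
have L_contract x : nm (L x) <= nm x.
  apply: (@le_of_small _ _ _ 1) => e /(hL x)[N /(_ N (leqnn _))].
  have := Y_contract N x; have := nmBD (L x) (Y N x) 0; rewrite !subr0 nmB; lra.
have L_bounded : nm_bounded L by exists 1 => x; rewrite mul1r.
have LL x : nm_lim (fun n => Y n (Y n x)) (L (L x)).
  move=> e e0; have [|N hN] := hL x (e / 2); first lra.
  have [|N' hN'] := hL (L x) (e / 2); first lra.
  exists (maxn N N') => n; rewrite geq_max => /andP[/hN h /hN' h'].
  have := nmBD (Y n (Y n x)) (Y n (L x)) (L (L x)).
  by rewrite -(linB (Y_linear n)); have := Y_contract n (Y n x - L x); lra.
have L_eq x : L x = (2^-1)%:C *: (X x + L (L x)).
  apply: nm_lim_uniq (nm_lim_shift (hL x)) _ => /=.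
  apply: (@nm_lim_op _ _ _ (fun z => (2^-1)%:C *: z) (fun n => X x + Y n (Y n x))).
  - exact: linear_scaler.
  - exact: nm_bounded_scale.
  - exact: nm_limD (nm_lim_cst _) (LL x).
have L_le x : rd (L x) x <= rd x x.
  apply: le_trans (rd_cs _ _) _; rewrite -nm_sqr expr2 ler_wpM2r ?nm_ge0//.
have Q_linear : linear (fun x => x - L x).
  by apply: linear_add (linear_opp L_linear) => a u v.
exists (fun x => x - L x); split.
- apply/positive_operatorE; split=> //.
  + exists 2 => x; have := nmD x (- L x); have := L_contract x; rewrite nmN; lra.
  + by move=> u v; rewrite !rdE L_symm.
  + by move=> x; rewrite !rdE subr_ge0.
- move=> x; have dbl : X x = L x + L x - L (L x).
    apply/eqP; rewrite eq_sym subr_eq eq_sym; apply/eqP.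
    rewrite -[RHS](_ : (2%:C : R[i]) *: L x = _).
      by rewrite [in RHS]L_eq scalerA -rmorphM mulfV ?scale1r.
    by rewrite (_ : 2%:C = 1 + 1 :> R[i]) ?scalerDl ?scale1r// rmorphD.
  by rewrite (linB L_linear) dbl !opprB !opprD !addrA [x - L x + _]addrAC.
- move=> Z lZ bZ ZX x; rewrite (linB lZ); congr (_ - _).
  have ZY n u : Z (Y n u) = Y n (Z u).
    elim: n u => [|n IH] u; first by rewrite (lin0 lZ).
    by rewrite /= (linZ lZ) (linD lZ) ZX !IH.
  apply: nm_lim_uniq (nm_lim_op lZ bZ (hL x)) _.
  by apply: nm_lim_eq (hL (Z x)) => n; rewrite /= ZY.
Qed.
End SquareRootSeries.

Section Closure.
Variables (R : realType) (E : innerType R).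

(** [g] is approximated by vectors orthogonal to it. This gives uniqueness of a vector in the
    closure of a range from its products with that range. *)
Lemma in_closure_uniq (A : set E) g : in_closure A g ->
  (forall z, A z -> rd z g = 0) -> g = 0.
Proof.
move=> clg h; apply: nm_eq0; apply: (@small_eq0 _ _ 1); first exact: nm_ge0.
move=> e e0; have [z Az hz] := clg e e0; rewrite mul1r.
apply: nm_le_rd; first exact: ltW.
rewrite -[rd g g]subr0 -(h _ Az) -rdNl -rdDl.
by apply: le_trans (rd_cs _ _) _; rewrite ler_wpM2r ?nm_ge0// ltW.
Qed.

Lemma in_closure_range_lin (G : lmodType R[i]) (T : G -> E) a x y :
  linear T -> in_closure (range T) x -> in_closure (range T) y ->
  in_closure (range T) (a *: x + y).
Proof.
move=> lT /in_closure_seq[u ux uT] /in_closure_seq[v vy vT].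
have h := nm_limD (nm_lim_op (@linear_scaler _ E a) (nm_bounded_scale E a) ux) vy.
apply: nm_lim_closure h _ => n /=.
by have [s _ <-] := uT n; have [t _ <-] := vT n; exists (a *: s + t); rewrite ?lT.
Qed.

Lemma rdZ_conj (a : R[i]) (x y : E) : rd x (a *: y) = rd (conjC a *: x) y.
Proof. by rewrite /rd linearZr_LR linearZl_LR. Qed.

Lemma rdZ_conjl (a : R[i]) (x y : E) : rd (a *: x) y = rd x (conjC a *: y).
Proof. by rewrite rdC rdZ_conj rdC. Qed.

End Closure.

Section Douglas.
Variables (R : realType) (G : lmodType R[i]) (E U : innerType R).
Variables (T : G -> E) (A : G -> U).
Hypothesis E_complete : nm_complete E.
Hypotheses (T_linear : linear T) (A_linear : linear A).

(* Douglas' factorisation [A = f^* T]. *)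
Lemma douglas C : 0 <= C -> (forall s, nm (A s) <= C * nm (T s)) ->
  exists f : U -> E, [/\ linear f, forall u, nm (f u) <= C * nm u,
    forall u, in_closure (range T) (f u) &
    forall s u, rd (T s) (f u) = rd (A s) u].
Proof.
move=> C0 AT.
have ex u : exists g, in_closure (range T) g /\ forall s, rd (A s) u = rd (T s) g.
  have [||c|g] := @riesz _ _ _ T (fun s => rd (A s) u) E_complete T_linear _ _ (C * nm u).
  - by move=> x y; rewrite (linD A_linear) rdDl.
  - by move=> r x; rewrite (linZ A_linear) rdZl.
  - apply: le_trans (rd_cs _ _) _; rewrite mulrAC ler_wpM2r ?nm_ge0//.
  - by exists g.
have [f hf] := choice ex; exists f; split.
- move=> a u v; apply/eqP; rewrite -subr_eq0; apply/eqP.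
  (* The defect of linearity lies in the closure of the range of [T] and is orthogonal to that
     range. *)
  apply: (@in_closure_uniq _ _ (range T)).
    rewrite [_ - _]addrC -scaleN1r; apply: in_closure_range_lin => //.
      by apply: in_closure_range_lin => //; [case: (hf u)|case: (hf v)].
    by case: (hf (a *: u + v)).
  move=> _ [s _ <-]; rewrite !rdE -(hf _).2 rdZ_conj -(linZ T_linear) -!(hf _).2.
  by rewrite !rdE rdZ_conj (linZ A_linear) subrr.
- move=> u; apply: (@nm_le_rd _ _ (f u)); first by rewrite mulr_ge0 ?nm_ge0.
  apply: (@le_of_small _ _ _ (nm (f u) + C * nm u)) => e e0.
  (* With [T s] close to [f u], [nm (f u) ^+ 2] is close to [<T s, f u> = <A s, u>], which is at
     most [C * nm (T s) * nm u]. *)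
  have [_ [s _ <-] hs] := (hf u).1 e e0.
  have h1 := ler_wpM2r (nm_ge0 (f u)) (ltW hs).
  have h2 := ler_wpM2r (nm_ge0 u) (AT s).
  have h3 : nm (T s) <= nm (f u) + e.
    by have := nmD (T s - f u) (f u); rewrite subrK (nmB (T s)); lra.
  have h4 := ler_wpM2l (mulr_ge0 C0 (nm_ge0 u)) h3.
  have := rd_cs (f u - T s) (f u); rewrite rdDl rdNl -(hf _).2.
  have := rd_cs (A s) u; lra.
- by move=> u; have [] := hf u.
- by move=> s u; have [_ ->] := hf u.
Qed.
End Douglas.

Lemma nm_bounded_comp (R : realType) (E F G : innerType R) (T : E -> F) (T' : F -> G) :
  nm_bounded T -> nm_bounded T' -> nm_bounded (fun x => T' (T x)).
Proof.
move=> [M hM] /nm_boundedP[M' M'0 hM']; exists (M' * M) => x.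
by apply: le_trans (hM' _) _; rewrite -mulrA ler_pM2l.
Qed.

Lemma nm_bounded_add (R : realType) (E F : innerType R) (T T' : E -> F) :
  nm_bounded T -> nm_bounded T' -> nm_bounded (fun x => T x + T' x).
Proof.
move=> [M hM] [M' hM']; exists (M + M') => x; apply: le_trans (nmD _ _) _.
by rewrite mulrDl lerD.
Qed.

Lemma nm_bounded_opp (R : realType) (E F : innerType R) (T : E -> F) :
  nm_bounded T -> nm_bounded (fun x => - T x).
Proof. by move=> [M hM]; exists M => x; rewrite nmN. Qed.

Lemma nm_bounded_scaled (R : realType) (E F : innerType R) (a : R[i]) (T : E -> F) :
  nm_bounded T -> nm_bounded (fun x => a *: T x).
Proof. by move=> /nm_bounded_comp; apply; exact: nm_bounded_scale. Qed.

(** * Orthogonal projections and adjoints from Douglas' factorisation *)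

Section RangeProjection.
Variables (R : realType) (E : innerType R) (Z : E -> E).
Hypothesis E_complete : nm_complete E.
Hypotheses (Z_linear : linear Z) (Z_symmetric : symmetric_op Z).

(** Factoring [Z] through itself with constant 1 gives [<Z s, p x> = <Z s, x>] with [p x] in the
    closure of the range of [Z], so [p] is the orthogonal projection onto that closure. *)
Lemma range_projection : exists p : E -> E,
  [/\ linear p /\ nm_bounded p, symmetric_op p, forall x, Z (x - p x) = 0,
      forall x, Z x = 0 -> p x = 0 &
      forall x, (forall y, Z y = 0 -> rd y x = 0) -> p x = x].
Proof.
have [||p [lp bp clp hp]] := @douglas _ _ _ _ Z Z E_complete Z_linear Z_linear 1.
- exact: ler01.
- by move=> s; rewrite mul1r.
have Zp x : Z (x - p x) = 0.
  apply: (@rd_ext _ _ _ 0) => z.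
  by rewrite Z_symmetric rdC rdDr rdNr hp subrr rd0l.
have orth x y : rd (p x) (y - p y) = 0.
  apply: etrans (rd0l (y - p y)); have [u ul uT] := in_closure_seq (clp x).
  apply: (rd_lim ul (@nm_lim_cst _ E 0)) => n.
  by have [s _ <-] := uT n; rewrite Z_symmetric Zp rd0r rd0l.
have sp : symmetric_op p.
  move=> x y; have := orth x y; have := orth y x; rewrite !rdDr !rdNr.
  by rewrite [rd (p y) (p x)]rdC [rd (p y) x]rdC; lra.
exists p; split=> // [|x Zx|x hx]; first by split=> //; exists 1.
  apply: in_closure_uniq (clp x) _ => _ [s _ <-].
  by rewrite hp Z_symmetric Zx rd0r.
apply/esym/eqP; rewrite -subr_eq0; apply/eqP/rd_eq0.
by rewrite [X in rd _ X](_ : _ = x + - p x)// rdDr rdNr hx ?Zp// rdC orth subrr.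
Qed.

End RangeProjection.

Section Adjoint.
Variables (R : realType).

Lemma adjointE (E F : innerType R) (T : E -> F) (T' : F -> E) :
  (forall x y, inner (T x) y = inner x (T' y)) -> adjoint T = T'.
Proof.
move=> h; apply: xget_unique => // T'' h''; apply/funext => y.
by apply: rd_ext => z; rewrite rdC [RHS]rdC /rd -h -h''.
Qed.

Lemma inner_of_rd (E F : innerType R) (T : E -> F) (T' : F -> E) : linear T ->
  (forall x y, rd (T x) y = rd x (T' y)) ->
  forall x y, inner (T x) y = inner x (T' y).
Proof.
by move=> lT h x y; apply: inner_rd_ext; rewrite // -(linZ lT) h.
Qed.

(** Douglas' factorisation through the identity produces an adjoint, so [xget] does not return its
    default. *)
Lemma adjointP (E F : innerType R) (T : E -> F) x y :
  nm_complete E -> linear T -> nm_bounded T ->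
  rd (T x) y = rd x (adjoint T y).
Proof.
move=> cE lT /nm_boundedP[M M0 hM].
have [|T' [_ _ _ hT']] := @douglas _ _ _ _ (@id E) T cE _ lT M (ltW M0) hM.
  by [].
rewrite (@adjointE _ _ _ T') ?hT'//.
by apply: inner_of_rd => // u v; rewrite hT'.
Qed.

Lemma adjoint_symmetric (E : innerType R) (T : E -> E) :
  linear T -> symmetric_op T -> adjoint T = T.
Proof. by move=> lT sT; apply: adjointE; apply: inner_of_rd. Qed.

End Adjoint.

(** * Positive square roots: existence, uniqueness and commutation *)

Section SquareRoot.
Variables (R : realType) (E : innerType R) (T : E -> E).
Hypothesis E_complete : nm_complete E.
Hypothesis T_positive : positive_operator T.

(** A bound [M] of [T] gives [T = M (1 - X)] with [0 <= X <= 1], which reduces to the root of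
    [1 - X]. *)
Lemma sqrt_exists : exists Q : E -> E,
  [/\ positive_operator Q, Q \o Q = T &
      forall Z, linear Z -> nm_bounded Z -> (forall x, Z (T x) = T (Z x)) ->
        forall x, Z (Q x) = Q (Z x)].
Proof.
have [lT /nm_boundedP[M M0 hM] sT pT] := (positive_operatorE T).1 T_positive.
pose X (x : E) := x - (M^-1)%:C *: T x.
have lX : linear X by apply: linear_add (linear_opp (linear_scale _ lT)) => a u v.
have sX : symmetric_op X by move=> u v; rewrite /X !rdE sT.
have M'0 : 0 < M^-1 by rewrite invr_gt0.
have pX : nonneg_op X.
  move=> x; rewrite /X !rdE subr_ge0 mulrC ler_pdivrMr//.
  apply: le_trans (rd_cs _ _) _; apply: le_trans (ler_wpM2r (nm_ge0 x) (hM x)) _.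
  by rewrite -mulrA -expr2 nm_sqr mulrC.
have X1 x : rd (X x) x <= rd x x.
  by rewrite /X !rdE gerDl oppr_le0 mulr_ge0 ?pT ?ltW.
(* Cauchy-Schwarz for the form of [X] at [x] and [X x], together with [X <= 1], bounds
   [nm (X x) ^+ 4] by [nm x ^+ 2 * nm (X x) ^+ 2]. *)
have cX x : nm (X x) <= nm x.
  have h := nonneg_cs x (X x) lX sX pX.
  have {h} h : nm (X x) ^+ 2 * nm (X x) ^+ 2 <= nm x ^+ 2 * nm (X x) ^+ 2.
    rewrite {1 2}nm_sqr -expr2; apply: le_trans h _; rewrite !nm_sqr.
    by apply: ler_pM; [exact: pX|exact: pX|exact: X1|exact: X1].
  rewrite -(@ler_pXn2r _ 2) ?nnegrE ?nm_ge0//.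
  have [->|n0] := eqVneq (nm (X x)) 0; first by rewrite expr0n sqr_ge0.
  by move: h; rewrite ler_pM2r// exprn_gt0// lt_neqAle eq_sym n0 nm_ge0.
have [Q0 [/positive_operatorE[lQ bQ sQ pQ] QQ QZ]] := sqrt_one_sub E_complete lX sX cX.
exists (fun x => (Num.sqrt M)%:C *: Q0 x); split.
- apply/positive_operatorE; split.
  + exact: linear_scale.
  + exact: nm_bounded_scaled.
  + by move=> u v; rewrite !rdE sQ.
  + by move=> u; rewrite !rdE mulr_ge0 ?sqrtr_ge0.
- apply/funext => x /=; rewrite (linZ lQ) scalerA -rmorphM -expr2 sqr_sqrtr ?ltW//.
  by rewrite QQ /X opprB addrC subrK scalerA -rmorphM mulfV ?gt_eqF// scale1r.
- move=> Z lZ bZ ZT x; rewrite (linZ lZ) QZ// => u.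
  by rewrite /X (linB lZ) (linZ lZ) ZT.
Qed.

(** For [y = Q x - Q' x], commutation gives [(Q + Q') y = 0]; nonnegativity then gives
    [Q y = Q' y = 0], and [<y, y> = <x, (Q - Q') y> = 0]. *)
Lemma sqrt_uniq Q Q' : positive_operator Q -> positive_operator Q' ->
  Q \o Q = T -> Q' \o Q' = T -> (forall x, Q (Q' x) = Q' (Q x)) -> Q = Q'.
Proof.
move=> /positive_operatorE[lQ bQ sQ pQ] /positive_operatorE[lQ' bQ' sQ' pQ'] QT QT' C.
apply/funext => x; apply/eqP; rewrite -subr_eq0; apply/eqP.
set y := Q x - Q' x.
have h : Q y + Q' y = 0.
  rewrite /y (linB lQ) (linB lQ') C addrA subrK.
  have /(congr1 (fun f : E -> E => f x)) /= -> := etrans QT (esym QT').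
  by rewrite subrr.
have h1 : rd (Q y) y + rd (Q' y) y = 0 by rewrite -rdDl h rd0l.
have Qy0 (Z : E -> E) : linear Z -> symmetric_op Z -> nonneg_op Z -> rd (Z y) y = 0 -> Z y = 0.
  move=> lZ sZ pZ z0; apply: rd_eq0; have := nonneg_cs y (Z y) lZ sZ pZ.
  rewrite z0 mul0r => ?; apply/eqP; rewrite -sqrf_eq0 eq_le sqr_ge0 andbT//.
have Q0 : Q y = 0 by apply: Qy0 => //; have := pQ y; have := pQ' y; lra.
have Q'0 : Q' y = 0 by move: h; rewrite Q0 add0r.
apply: rd_eq0; rewrite {1}/y rdDl rdNl sQ sQ' Q0 Q'0 !rd0r.
by rewrite subrr.
Qed.

Lemma sqrt_operatorP : positive_operator (sqrt_operator T) /\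
  sqrt_operator T \o sqrt_operator T = T.
Proof.
have [Q [? ? _]] := sqrt_exists.
by apply: (@xgetPex _ _ [set Q | positive_operator Q /\ Q \o Q = T]); exists Q.
Qed.

(** A root of [T] commutes with [T], hence with the constructed root [Q]; so the chosen positive
    root equals [Q]. *)
Lemma sqrt_operator_comm Z : linear Z -> nm_bounded Z ->
  (forall x, Z (T x) = T (Z x)) ->
  forall x, Z (sqrt_operator T x) = sqrt_operator T (Z x).
Proof.
have := sqrt_operatorP; move: (sqrt_operator T) => S [pS SS].
have [Q [pQ QQ QZ]] := sqrt_exists.
have -> : S = Q; last exact: QZ.
have /positive_operatorE[lS bS _ _] := pS.
by apply: sqrt_uniq => // x; apply: QZ => // y; rewrite -SS.
Qed.

Lemma sqrt_operator_sqr x : sqrt_operator T (sqrt_operator T x) = T x.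
Proof. by have [_ h] := sqrt_operatorP; rewrite -[in RHS]h. Qed.

Lemma nm_sqrt_operator x : nm (sqrt_operator T x) ^+ 2 = rd (T x) x.
Proof.
have [/positive_operatorE[_ _ sS _] _] := sqrt_operatorP.
by rewrite nm_sqr -sS sqrt_operator_sqr.
Qed.

Lemma sqrt_operator_ker x : sqrt_operator T x = 0 <-> T x = 0.
Proof.
have [/positive_operatorE[lS _ _ _] _] := sqrt_operatorP.
split=> h; first by rewrite -sqrt_operator_sqr h (lin0 lS).
by apply: nm_eq0; apply/eqP; rewrite -sqrf_eq0 nm_sqrt_operator h rd0l.
Qed.

End SquareRoot.

(** * Polar decomposition of a bounded symmetric operator *)

Section AbsoluteValue.
Variables (R : realType) (E : innerType R) (a : E -> E).
Hypothesis E_complete : nm_complete E.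
Hypotheses (a_linear : linear a) (a_bounded : nm_bounded a).
Hypothesis a_symmetric : symmetric_op a.

Local Notation Q := (abs_operator a).
Local Notation P := (sqrt_operator (abs_operator a)).

Let sqr_positive : positive_operator (adjoint a \o a).
Proof.
rewrite adjoint_symmetric//; apply/positive_operatorE; split=> /=.
- exact: linear_comp.
- exact: nm_bounded_comp.
- by move=> x y; rewrite !a_symmetric.
- by move=> x; rewrite a_symmetric rd_ge0.
Qed.

Lemma abs_positive : positive_operator Q.
Proof. by have [] := sqrt_operatorP E_complete sqr_positive. Qed.

Let absE : [/\ linear Q, nm_bounded Q, symmetric_op Q & nonneg_op Q].
Proof. exact/positive_operatorE/abs_positive. Qed.

Let Q_linear : linear Q. Proof. by case: absE. Qed.
Let Q_bounded : nm_bounded Q. Proof. by case: absE. Qed.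
Let Q_symmetric : symmetric_op Q. Proof. by case: absE. Qed.

Let QQ x : Q (Q x) = a (a x).
Proof.
rewrite /abs_operator sqrt_operator_sqr//=; by rewrite adjoint_symmetric.
Qed.

Lemma nm_abs x : nm (Q x) = nm (a x).
Proof.
by apply/eqP; rewrite -(@eqrXn2 _ 2) ?nm_ge0// !nm_sqr -Q_symmetric QQ a_symmetric.
Qed.

Lemma abs_comm Z : linear Z -> nm_bounded Z -> (forall x, Z (a x) = a (Z x)) ->
  forall x, Z (Q x) = Q (Z x).
Proof.
move=> lZ bZ Za; apply: sqrt_operator_comm => // x.
by rewrite adjoint_symmetric//= !Za.
Qed.

Lemma abs_ker x : Q x = 0 <-> a x = 0.
Proof.
by split=> h; apply: nm_eq0; [rewrite -nm_abs|rewrite nm_abs]; rewrite h nm0.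
Qed.

Let aQ x : a (Q x) = Q (a x). Proof. exact: abs_comm. Qed.

Lemma sqrt_abs_positive : positive_operator P.
Proof. by have [] := sqrt_operatorP E_complete abs_positive. Qed.

(* [u = p - 2 q] with [p], [q] the projections onto the closed ranges of [|a|]
   and of the negative part [a - |a|]. *)
Lemma polar_exists : exists u : E -> E,
  [/\ linear u /\ nm_bounded u, symmetric_op u,
      (forall x, u (Q x) = a x) /\ (forall x, u (a x) = Q x),
      forall x, a x = 0 -> u x = 0 &
      forall x, (forall y, Q y = 0 -> rd y x = 0) -> u (u x) = x].
Proof.
pose Z x := a x - Q x.
have lZ : linear Z by apply: linear_add => //; exact: linear_opp.
have bZ : nm_bounded Z by apply: nm_bounded_add => //; exact: nm_bounded_opp.
have sZ : symmetric_op Z.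
  by move=> x y; rewrite /Z !rdE a_symmetric Q_symmetric.
have [p [[lp bp] sp hp p0 pid]] := range_projection E_complete Q_linear Q_symmetric.
have [q [[lq bq] sq hq q0 qid]] := range_projection E_complete lZ sZ.
have qZ x : q (Z x) = Z x by apply: qid => y Zy; rewrite -sZ Zy rd0l.
have pQ x : p (Q x) = Q x by apply: pid => y Qy; rewrite -Q_symmetric Qy rd0l.
have pa x : p (a x) = a x.
  by apply: pid => y /abs_ker ay; rewrite -a_symmetric ay rd0l.
(* [(a - |a|) (a + |a|) = 0], so [a + |a|] maps into the kernel of [Z], which [q] annihilates. *)
have qs x : q (a x + Q x) = 0.
  by apply: q0; rewrite /Z (linD a_linear) (linD Q_linear) QQ aQ
     [X in _ - X]addrC subrr.
pose u x := p x - 2%:C *: q x.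
have lu : linear u by apply: linear_add => //; apply: linear_opp; exact: linear_scale.
have bu : nm_bounded u.
  by apply: nm_bounded_add => //; apply: nm_bounded_opp; exact: nm_bounded_scaled.
have su : symmetric_op u by move=> x y; rewrite /u !rdE sp sq.
have two (x : E) : 2%:C *: x = x + x.
  by rewrite (_ : 2%:C = 1 + 1 :> R[i]) ?scalerDl ?scale1r// rmorphD.
have qaE x : q (a x) = - q (Q x).
  by apply/eqP; rewrite -addr_eq0 -(linD lq) qs.
have qaB x : q (a x) - q (Q x) = a x - Q x by rewrite -(linB lq) qZ.
have uQ x : u (Q x) = a x.
  by rewrite /u pQ two opprD -{1}qaE qaB addrC subrK.
have ua x : u (a x) = Q x.
  by rewrite /u pa two {1}qaE [- q _ + _]addrC qaB opprB addrC subrK.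
have qp x : q (p x) = q x.
  apply/esym/eqP; rewrite -subr_eq0 -(linB lq); apply/eqP/q0.
  by rewrite /Z (abs_ker _).1 hp// subr0.
have pq x : p (q x) = q x by apply: rd_ext => y; rewrite sp sq qp sq.
have pp x : p (p x) = p x.
  by apply/esym/eqP; rewrite -subr_eq0 -(linB lp); apply/eqP/p0.
have qq x : q (q x) = q x.
  by apply/esym/eqP; rewrite -subr_eq0 -(linB lq); apply/eqP/q0.
exists u; split=> // [x ax|x hx].
  have Qx : Q x = 0 by apply/abs_ker.
  by rewrite /u p0// q0 ?scaler0 ?subr0// /Z ax Qx subr0.
(* [p q = q p = q], so [(p - 2 q)^2 = p - 4 q + 4 q = p], and [p] fixes vectors orthogonal to the
   kernel of [|a|]. *)
rewrite {2}/u (linB lu) (linZ lu) /u pp qp pq qq !two pid//.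
have -> : q x - (q x + q x) = - q x by rewrite opprD addrA subrr add0r.
by rewrite -opprD opprK subrK.
Qed.

(** Identifies the chosen factor with the symmetric [u] of [polar_exists], which commutes with
    [|a|^(1/2)]. *)
Lemma polar_factorP : [/\ linear (polar_factor a), nm_bounded (polar_factor a),
  forall x, polar_factor a (P x) = P (polar_factor a x),
  forall x, P (polar_factor a (P x)) = a x &
  forall x, polar_factor a (polar_factor a (P x)) = P x].
Proof.
have [u [[lu bu] su [uQ ua] u0 uu]] := polar_exists.
have ker_u : nullspace u = nullspace a.
  apply/seteqP; split=> x /=; last exact: u0.
  move=> ux; apply: (@rd_ext _ _ _ 0) => y.
  by rewrite rd0l a_symmetric -uQ -su ux rd0l.
pose G := [set v : E -> E |
  [/\ partial_isometry v, a = v \o Q & nullspace v = nullspace a]].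
have Gu : G u.
  split=> //; last by apply/funext => x; rewrite /= uQ.
  split=> [|x hx]; first by apply/bounded_operatorE.
  have uux : u (u x) = x.
    apply: uu => y /abs_ker ay; rewrite rdC /rd hx// ker_u//.
  by rewrite !norm_nm /nm su uux.
have [[/bounded_operatorE[lv bv] _] av ker_v] : G (polar_factor a).
  by apply: xgetPex; exists u.
have -> : polar_factor a = u.
  move: (polar_factor a) lv bv av ker_v => v lv bv av ker_v.
  pose d x := v x - u x.
  have ld : linear d by apply: linear_add => //; exact: linear_opp.
  have bd : nm_bounded d by apply: nm_bounded_add => //; exact: nm_bounded_opp.
  have dQ x : d (Q x) = 0.
    by rewrite /d uQ [in X in _ - X]av subrr.
  have d0 x : a x = 0 -> d x = 0.
    move=> ax; have : nullspace v x by rewrite ker_v.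
    by rewrite /d /nullspace /= u0// subr0.
  (* [d |a| = 0] puts the range of the adjoint of [d] into the kernel of [a], where [d] vanishes; so
     [d] composed with its adjoint is 0. *)
  have dadj y : adjoint d y = 0.
    apply: rd_eq0; rewrite -adjointP// d0 ?rd0l//; apply/abs_ker.
    apply: (@rd_ext _ _ _ 0) => z.
    by rewrite Q_symmetric rdC -adjointP// dQ !rd0l.
  apply/funext => x; apply/eqP; rewrite -subr_eq0; apply/eqP; apply: (@rd_ext _ _ _ 0) => y.
  by rewrite -/(d x) adjointP// dadj rd0r rd0l.
have Qu x : Q (u x) = a x.
  by apply: rd_ext => y; rewrite Q_symmetric su uQ a_symmetric.
have uP x : u (P x) = P (u x).
  apply: sqrt_operator_comm => //; first exact: abs_positive.
  by move=> y; rewrite uQ Qu.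
split=> // x.
  by rewrite uP sqrt_operator_sqr ?Qu//; exact: abs_positive.
apply: uu => y Qy; have /positive_operatorE[_ _ sP _] := sqrt_abs_positive.
rewrite -sP (_ : P y = 0) ?rd0l//; apply/sqrt_operator_ker => //.
exact: abs_positive.
Qed.

End AbsoluteValue.

(** * Comparison of nonnegative forms *)

Section FormComparison.
Variables (R : realType) (E F : innerType R) (j : E -> F).
Variables (A : E -> E) (B : F -> F).
Hypothesis j_linear : linear j.
Hypotheses (A_linear : linear A) (B_linear : linear B).
Hypotheses (A_symmetric : symmetric_op A) (B_symmetric : symmetric_op B).
Hypothesis A_nonneg : nonneg_op A.
Variables (k c MA MB : R).
Hypotheses (k_gt0 : 0 < k) (c_gt0 : 0 < c).
Hypothesis j_le : forall x, nm (j x) <= k * nm x.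
Hypothesis A_le : forall x, nm (A x) <= MA * nm x.
Hypothesis B_le : forall x, nm (B x) <= MB * nm x.
Hypothesis BA_le : forall x, nm (B (j x)) <= c * nm (A x).

Let C := c * k.

Let C_gt0 : 0 < C. Proof. exact: mulr_gt0. Qed.

Let q x y := C * rd (A x) y - rd (B (j x)) (j y).

Let qC x y : q x y = q y x.
Proof.
by rewrite /q A_symmetric B_symmetric rdC [rd (j x) _]rdC.
Qed.

Let qDl x y z : q (x + y) z = q x z + q y z.
Proof.
by rewrite /q (linD A_linear) (linD j_linear) (linD B_linear) !rdDl; ring.
Qed.

Let qZl r x z : q (r%:C *: x) z = r * q x z.
Proof.
by rewrite /q (linZ A_linear) (linZ j_linear) (linZ B_linear) !rdZl; ring.
Qed.

Let D := C * `|MA| + `|MB| * k ^+ 2.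

Let q_bound x : `|q x x| <= D * nm x ^+ 2.
Proof.
have h (G : innerType R) (T : G -> G) M y : (forall x, nm (T x) <= M * nm x) ->
    `|rd (T y) y| <= `|M| * nm y ^+ 2.
  move=> hT; apply: le_trans (rd_cs_norm _ _) _.
  rewrite expr2 mulrA ler_wpM2r ?nm_ge0//; apply: le_trans (hT y) _.
  by rewrite ler_wpM2r ?nm_ge0// ler_norm.
apply: le_trans (ler_normB _ _) _; rewrite mulrDl; apply: lerD.
  by rewrite normrM gtr0_norm// -mulrA ler_pM2l// h.
apply: le_trans (h _ _ _ _ B_le) _; rewrite -mulrA ler_wpM2l ?normr_ge0//.
rewrite -exprMn lerXn2r// ?nnegrE ?mulr_ge0 ?nm_ge0// ltW//.
Qed.

(* If the form [C <A x, x> - <B j x, j x>] had negative infimum [- mu] on the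
   unit sphere, then [B j x] would be close to [C A x + mu x], which is longer
   than [C A x], at almost minimising [x]. *)
Lemma form_comparison x : rd (B (j x)) (j x) <= C * rd (A x) x.
Proof.
rewrite -subr_ge0 -/(q x x) leNgt; apply/negP => qx.
have unit (y : E) : y != 0 -> exists z, nm z = 1 /\ y = (nm y)%:C *: z.
  move=> y0; have ny : nm y != 0 by apply: contra_neq y0 => /nm_eq0.
  exists ((nm y)^-1%:C *: y); rewrite nmZ ger0_norm ?invr_ge0 ?nm_ge0//.
  by rewrite mulVf// scalerA -rmorphM mulfV// scale1r.
pose S := [set q z z | z in [set z | nm z = 1]].
have S_inf : has_inf S.
  split; last first.
    exists (- D) => _ [z z1 <-]; have := q_bound z; rewrite z1 expr1n mulr1.
    by rewrite ler_norml => /andP[].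
  have [|z [z1 _]] := unit x; last by exists (q z z), z.
  by apply: contraTneq qx => ->; rewrite /q (lin0 A_linear) (lin0 j_linear) !rd0r; lra.
pose m := inf S.
have mq z : m * nm z ^+ 2 <= q z z.
  have [->|/unit[z' [z'1 ->]]] := eqVneq z 0.
    by rewrite nm0 expr0n mulr0 /q (lin0 A_linear) (lin0 j_linear) !rd0r; lra.
  rewrite qZl qC qZl mulrA -expr2 nmZ z'1 mulr1 ger0_norm ?nm_ge0// mulrC.
  rewrite ler_wpM2l ?sqr_ge0//; apply: ge_inf; first by case: S_inf.
  by exists z'.
have m0 : m < 0.
  rewrite ltNge; apply/negP => m0; move: qx; rewrite ltNge => /negP; apply.
  by apply: le_trans (mq x); rewrite mulr_ge0 ?sqr_ge0.
pose h y z := q y z - m * rd y z.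
have h_ge0 y : 0 <= h y y by rewrite /h subr_ge0 -nm_sqr.
have hcs y z : h y z ^+ 2 <= h y y * h z z.
  apply: quadratic_ge0 => // r; have := h_ge0 (y + r%:C *: z).
  rewrite /h qDl qZl [q y (_ + _)]qC [q z (_ + _)]qC !qDl !qZl !rdE.
  by rewrite [q z y]qC [rd z y]rdC; lra.
have D0 : 0 <= D by rewrite addr_ge0// mulr_ge0 ?normr_ge0// ?sqr_ge0// ltW.
have h_le y : h y y <= (D - m) * nm y ^+ 2.
  by rewrite /h mulrBl nm_sqr lerB// -nm_sqr (le_trans (ler_norm _))// q_bound.
have Dm : 0 < D - m by lra.
suff : m ^+ 2 <= 0 by rewrite leNgt exprn_even_gt0//= ltr0_neq0.
apply: (@le_of_small _ _ _ (1 + 2 * C * `|MA|)) => e0 e0_gt0.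
(* Capping at 1 gives [e ^+ 2 <= e], which makes the final estimate linear in [e]. *)
pose e := Num.min e0 1.
have e_gt0 : 0 < e by rewrite lt_min e0_gt0 ltr01.
have ee : e ^+ 2 <= e by rewrite expr2 ler_piMl ?(ltW e_gt0)// ge_min lexx orbT.
have ee0 : e <= e0 by rewrite ge_min lexx.
(* The excess is divided by the bound [D - m] of [h], so that Cauchy-Schwarz for [h] gives
   [h y z <= e * nm z]. *)
have [|_ [y /= y1 <-] hy] := @inf_adherent _ S (e ^+ 2 / (D - m)) _ S_inf.
  by rewrite divr_gt0 ?exprn_gt0.
have {}hy : h y y < e ^+ 2 / (D - m) by rewrite /h -nm_sqr y1 expr1n; lra.
pose z := C%:C *: A y - m%:C *: y.
have h1 : h y z <= e * nm z.
  apply: le_trans (ler_norm _) _.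
  rewrite -(@ler_pXn2r _ 2)// ?nnegrE ?mulr_ge0 ?nm_ge0 ?(ltW e_gt0)//.
  rewrite real_normK ?num_real//; apply: le_trans (hcs _ _) _.
  apply: le_trans (ler_pM (h_ge0 y) (h_ge0 z) (ltW hy) (h_le z)) _.
  by rewrite exprMn mulrA divfK// gt_eqF.
have z2 : nm z ^+ 2 = h y z + rd (B (j y)) (j z).
  rewrite nm_sqr {1}/z rdDl rdNl !rdZl /h /q; ring.
have h2 : rd (B (j y)) (j z) <= C * nm (A y) * nm z.
  apply: le_trans (rd_cs _ _) _; 
  apply: le_trans (ler_pM (nm_ge0 _) (nm_ge0 _) (BA_le y) (j_le z)) _.
  by rewrite /C; lra.
have z_le : nm z <= e + C * nm (A y).
  apply: nm_le_rd; first by rewrite addr_ge0 ?mulr_ge0 ?nm_ge0 ?ltW.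
  by rewrite -nm_sqr z2 mulrDl; lra.
(* [m < 0] and [A] nonnegative fix the sign of the cross term. With [z_le] this leaves
   [m ^+ 2 <= e ^+ 2 + 2 e C nm (A y)]. *)
have z_ge : C ^+ 2 * nm (A y) ^+ 2 + m ^+ 2 <= nm z ^+ 2.
  have -> : nm z ^+ 2 = C ^+ 2 * nm (A y) ^+ 2 + m ^+ 2 * nm y ^+ 2 - 2 * (m * C) * rd (A y) y.
    by rewrite !nm_sqr /z !rdE [rd y (A y)]rdC; ring.
  rewrite y1 expr1n mulr1 lerDl oppr_ge0 mulr_le0_ge0 ?A_nonneg//.
  by rewrite mulr_ge0_le0// nmulr_rle0 ?ltW.
have Ay : nm (A y) <= `|MA|.
  by apply: le_trans (A_le y) _; rewrite y1 mulr1 ler_norm.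
have : nm z ^+ 2 <= (e + C * nm (A y)) ^+ 2.
  by rewrite lerXn2r// nnegrE ?nm_ge0// addr_ge0 ?mulr_ge0 ?nm_ge0 ?ltW.
have h3 : e * (C * nm (A y)) <= e * (C * `|MA|) by rewrite ler_pM2l// ler_pM2l.
have : (1 + 2 * C * `|MA|) * e <= (1 + 2 * C * `|MA|) * e0.
  by rewrite ler_wpM2l// addr_ge0// !mulr_ge0// ltW.
rewrite sqrrD exprMn; lra.
Qed.

End FormComparison.

(** * Closed subspaces and Schur complements *)

Lemma in_closureE (R : realType) (E : innerType R) (A : set E) x :
  closure A x <-> in_closure A x.
Proof.
split=> [clx e e0|clx B].
  have [|y [Ay]] := clx (ball x e%:C).
    by apply: nbhsx_ballx; rewrite -[0]/(0%:C) ltcR.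
  by rewrite -ball_normE /= norm_nm ltcR; exists y.
move=> /nbhs_ballP[e /= e0 xB].
have eE : e = (complex.Re e)%:C by rewrite RRe_real// ger0_real// ltW.
have [|y Ay hy] := clx (complex.Re e); first by rewrite -ltcR -eE.
exists y; split=> //; apply: xB.
by rewrite -ball_normE /= norm_nm eE ltcR.
Qed.

Lemma inner_eq0 (R : realType) (E : innerType R) (x y : E) :
  rd x y = 0 -> rd x ('i%C *: y) = 0 -> inner x y = 0.
Proof.
rewrite /rd linearZr_LR /=; case: (inner x y) => a b /= -> h.
by congr (_ +i* _); move: h; lra.
Qed.

Section Subspaces.
Variables (R : realType) (E : innerType R).

Definition nm_closed (S : {pred E}) :=
  forall x, in_closure [set y | y \in S] x -> x \in S.

Lemma closed_nm_closed (S : {pred E}) : closed [set x | x \in S] -> nm_closed S.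
Proof. by move=> cS x /in_closureE /cS. Qed.

Lemma orth_compl_closed (S : submodClosed E) : nm_closed (orth_compl S).
Proof.
move=> x clx; apply/asboolP => y yS.
have [u ul uS] := in_closure_seq clx.
have h (z : E) : z \in S -> rd x z = 0.
  move=> zS; rewrite -(rd0l z); apply: (rd_lim ul (@nm_lim_cst _ E 0)) => n.
  by have /asboolP h := uS n; rewrite rd0l /rd h.
by apply: inner_eq0; apply: h; rewrite ?rpredZ.
Qed.

Lemma lin_subspace_complete (S : submodClosed E) : nm_complete E ->
  nm_closed S -> nm_complete (lin_subspace S).
Proof.
move=> cE cS u cu; have [l hl] := cE (fun n => subval (u n)) cu.
have lS : l \in S.
  apply: cS; apply: nm_lim_closure hl _ => n /=; exact: valP.
by exists (Subspace lS).
Qed.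

Lemma subval_linear (S : submodClosed E) : linear (@subval _ _ S).
Proof. by []. Qed.

Section Projection.
Variable S : submodClosed E.
Hypotheses (E_complete : nm_complete E) (S_closed : nm_closed S).

(** Douglas' factorisation of the inclusion of [S] through itself is the projection; closedness of
    [S] puts its values in [S]. *)
Lemma orth_projP x (t : lin_subspace S) :
  inner (x - subval (orth_proj S x)) (subval t) = 0.
Proof.
have [|p [_ _ clp hp]] := @douglas _ _ _ E (@subval _ _ S) (@subval _ _ S) E_complete
  (@subval_linear S) (@subval_linear S) 1 ler01.
  by move=> s; rewrite mul1r.
suff ex : exists s : lin_subspace S, forall t : lin_subspace S,
    inner (x - subval s) (subval t) = 0.
  exact: (@xgetPex _ _ [set s | forall t : lin_subspace S,
    inner (x - subval s) (subval t) = 0]).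
have pS : p x \in S.
  apply: S_closed; have [u ul uS] := in_closure_seq (clp x).
  by apply: nm_lim_closure ul _ => n; have [s _ <-] := uS n; exact: valP.
have h (s : lin_subspace S) : rd (x - p x) (subval s) = 0.
  by rewrite rdDl rdNl [rd (p x) _]rdC hp rdC subrr.
exists (Subspace pS) => s; apply: inner_eq0; first exact: h.
exact: (h ('i%C *: s)).
Qed.

Lemma rd_orth_proj x t : rd (orth_proj S x) t = rd x (subval t).
Proof.
apply/esym/eqP; rewrite -subr_eq0 -[rd (orth_proj _ _) _]/(rd (subval _) (subval t)).
by rewrite -rdNl -rdDl /rd orth_projP.
Qed.

Lemma orth_proj_linear : linear (orth_proj S).
Proof.
move=> a x y; apply: rd_ext => t.
by rewrite rdDl rdZ_conjl !rd_orth_proj rdDl rdZ_conjl.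
Qed.

Lemma nm_orth_proj x : nm (orth_proj S x) <= nm x.
Proof.
apply: nm_le_rd; first exact: nm_ge0.
by rewrite rd_orth_proj; apply: rd_cs.
Qed.

Lemma orth_proj_id (s : lin_subspace S) : orth_proj S (subval s) = s.
Proof. by apply: rd_ext => t; rewrite rd_orth_proj. Qed.

End Projection.

Section Decomposition.
Variable S : submodClosed E.
Hypotheses (E_complete : nm_complete E) (S_closed : nm_closed S).

Lemma rd_orth_compl (s : lin_subspace S) (t : lin_subspace (orth_compl S)) :
  rd (subval s) (subval t) = 0.
Proof.
have /asboolP h := valP t; rewrite rdC /rd (h (subval s)) //; exact: valP.
Qed.

Lemma orth_proj_sum x :
  x = subval (orth_proj S x) + subval (orth_proj (orth_compl S) x).
Proof.
have xS : x - subval (orth_proj S x) \in orth_compl S.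
  by apply/asboolP => y yS; exact: (orth_projP E_complete S_closed x (Subspace yS)).
have cSo := @orth_compl_closed S.
rewrite addrC; apply/eqP; rewrite -subr_eq; apply/eqP.
rewrite -[LHS]/(subval (Subspace xS)) -(orth_proj_id E_complete cSo (Subspace xS)).
congr subval; apply: rd_ext => t; rewrite !(rd_orth_proj E_complete cSo).
by rewrite rdDl rdNl rd_orth_compl subr0.
Qed.

End Decomposition.

End Subspaces.

(** * Schur complement in a Hilbert space *)

Section Schur.
Variables (R : realType) (E : innerType R) (S : submodClosed E) (B : E -> E).
Hypotheses (E_complete : nm_complete E) (S_closed : nm_closed S).
Hypotheses (B_linear : linear B) (B_bounded : nm_bounded B).
Hypothesis B_symmetric : symmetric_op B.

Local Notation So := (orth_compl S).
Local Notation a := (block S S B).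
Local Notation b := (block S So B).
Local Notation P := (sqrt_operator (abs_operator a)).

Let F_complete : nm_complete (lin_subspace S).
Proof. exact: lin_subspace_complete. Qed.

Let So_closed : nm_closed So. Proof. exact: orth_compl_closed. Qed.

Let G_complete : nm_complete (lin_subspace So).
Proof. exact: lin_subspace_complete. Qed.

Lemma rd_block (T : submodClosed E) (t : lin_subspace T) (s : lin_subspace S) :
  rd (block S T B t) s = rd (B (subval t)) (subval s).
Proof. exact: rd_orth_proj. Qed.

Lemma block_linear : linear a.
Proof. by move=> c s t; rewrite /block B_linear orth_proj_linear. Qed.

Lemma block_bounded : nm_bounded a.
Proof.
have [M M0 hM] := nm_boundedP B_bounded; exists M => s.
by apply: le_trans (nm_orth_proj E_complete S_closed _) _; exact: hM.
Qed.

Lemma block_symmetric : symmetric_op a.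
Proof. by move=> s t; rewrite rd_block B_symmetric [RHS]rdC rd_block rdC. Qed.

Let P_positive : positive_operator P.
Proof.
exact: sqrt_abs_positive F_complete block_linear block_bounded block_symmetric.
Qed.

Let P_linear : linear P. Proof. by have /positive_operatorE[] := P_positive. Qed.
Let P_symmetric : symmetric_op P.
Proof. by have /positive_operatorE[] := P_positive. Qed.

Lemma rd_B_split x (s : lin_subspace S) :
  rd (B x) (subval s) = rd (a (orth_proj S x) + b (orth_proj So x)) s.
Proof.
by rewrite rdDl !rd_block -rdDl -(linD B_linear) -orth_proj_sum.
Qed.

(** With [b x_o = P g] for the component [x_o] of [x] orthogonal to [S], and [a = P u P], one gets
    [<B s, x> = <P s, u P x_S + g>]. So [B] maps the vectors with [nm (P s) <= 1] to a pointwise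
    bounded set, and uniform boundedness applies. *)
Lemma weakly_complementable_bound : weakly_complementable S B ->
  exists2 C, 0 <= C & forall s, nm (B (subval s)) <= C * nm (P s).
Proof.
move=> wc.
have [_ _ _ PuP _] := polar_factorP F_complete block_linear block_bounded block_symmetric.
pose V := [set B (subval s) | s in [set s : lin_subspace S | nm (P s) <= 1]].
have [|C hC] := @uniform_boundedness _ _ V E_complete.
  move=> x; have [g _ hg] := wc (b (orth_proj So x)) (imageT _ _).
  pose v := polar_factor a (P (orth_proj S x)) + g.
  exists (nm v) => _ [s /= s1 <-].
  rewrite -B_symmetric rd_B_split -PuP -hg -(linD P_linear) P_symmetric -/v.
  by apply: le_trans (rd_cs _ _) _; rewrite ler_piMr ?nm_ge0.
have C0 : 0 <= C.
  apply: le_trans (nm_ge0 _) (hC (B (subval (0 : lin_subspace S))) _); exists 0 => //=.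
  by rewrite (lin0 P_linear) nm0.
exists C => //; apply: (@le_of_unit_ball _ _ (fun s : lin_subspace S => nm (B (subval s)))).
- by move=> r s; rewrite -nmZ -(linZ B_linear).
- by move=> r s; rewrite (linZ P_linear) nmZ.
- by move=> s; exact: nm_ge0.
- by move=> s s1; apply: hC; exists s.
Qed.

Section Bound.
Variable C : R.
Hypotheses (C_ge0 : 0 <= C) (B_le : forall s, nm (B (subval s)) <= C * nm (P s)).

(** [block So S B] is the adjoint of [b], so factoring it through [P] gives [f] with [P f = b]. The
    values of [f] lie in the closure of the range of [P], where [P] is injective, so [f] and [b]
    have the same kernel. *)
Lemma reduced_solutionP : [/\ nm_bounded (reduced_solution P b),
  linear (reduced_solution P b),
  forall y, P (reduced_solution P b y) = b y &
  forall y, in_closure (range P) (reduced_solution P b y)].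
Proof.
have [||f [lf bf clf hf]] := @douglas _ _ _ _ P (block So S B) F_complete P_linear _ C C_ge0.
- by move=> c s t; rewrite /block B_linear (orth_proj_linear E_complete So_closed).
- by move=> s; apply: le_trans (nm_orth_proj E_complete So_closed _) _; exact: B_le.
have Pf y : P (f y) = b y.
  apply: rd_ext => s; rewrite P_symmetric rdC hf rd_orth_proj// rdC.
  by rewrite -B_symmetric -rd_block.
have [/bounded_operatorE[lg bg] eg _ clg] : [/\ bounded_operator (reduced_solution P b),
    b = P \o reduced_solution P b, nullspace (reduced_solution P b) = nullspace b &
    range (reduced_solution P b) `<=` closure (range P)].
  apply: (@xgetPex _ _ [set f | [/\ bounded_operator f, b = P \o f,
    nullspace f = nullspace b & range f `<=` closure (range P)]]); exists f; split.
  - by apply/bounded_operatorE; split=> //; exists C.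
  - by apply/funext => y /=; rewrite Pf.
  - apply/seteqP; split=> y /= fy; first by rewrite /nullspace /= -Pf fy (lin0 P_linear).
    apply: in_closure_uniq (clf y) _ => _ [s _ <-].
    by rewrite P_symmetric Pf fy rd0r.
  - by move=> _ [y _ <-]; apply/in_closureE.
split=> // y; first by rewrite [in RHS]eg.
by apply/in_closureE/clg; exists y.
Qed.

(* [t] is [x_S + u r] where [|a|^(1/2) r] approximates the reduced solution at
   the component of [x] orthogonal to [S]. *)
Lemma schur_approx : exists q : E -> R, (forall y, 0 <= q y) /\
  forall x, exists M, forall e, 0 < e -> e <= 1 -> exists t : lin_subspace S,
    [/\ nm (P t) <= M,
      forall s : lin_subspace S, `|rd (B (x - subval t)) (subval s)| <= e * nm (P s) &
      forall y, `|rd (B (x - subval t)) y - rd (schur_complement S B x) y| <= e * q y].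
Proof.
have [lu bu uP PuP uuP] := polar_factorP F_complete block_linear block_bounded block_symmetric.
have [bf lf Pf clf] := reduced_solutionP.
set u := polar_factor a in lu bu uP PuP uuP *.
set f := reduced_solution P b in bf lf Pf clf *.
have [K K0 hK] := nm_boundedP bu.
pose xo x := orth_proj So x.
have schE x y : rd (schur_complement S B x) y =
    rd (B (subval (xo x))) (subval (xo y)) - rd (u (f (xo x))) (f (xo y)).
  rewrite {1}(orth_proj_sum E_complete S_closed y) rdDr.
  rewrite [X in X + _](_ : _ = 0) ?add0r; last by rewrite rdC rd_orth_compl.
  rewrite /schur_complement -/u -/f -[LHS]/(rd (_ - _) (orth_proj So y)).
  rewrite rdDl rdNl (rd_orth_proj E_complete So_closed); congr (_ - _).
  by rewrite rdC -(adjointP _ _ G_complete lf bf) rdC.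
(* The two terms bound the errors from the components of [y] orthogonal to [S] and in [S]. *)
exists (fun y => K * nm (f (xo y)) + nm (P (orth_proj S y))); split.
  by move=> y; rewrite addr_ge0 ?nm_ge0// mulr_ge0 ?nm_ge0// ltW.
(* [P t = P x_S + u P r], and [P r] is within [e <= 1] of [f x_o]. *)
move=> x; exists (nm (P (orth_proj S x)) + K * (nm (f (xo x)) + 1)) => e e0 e1.
have [_ [r _ <-] hr] := clf (xo x) e e0.
pose t := orth_proj S x + u r.
have xt : x - subval t = subval (xo x) - subval (u r).
  rewrite {1}(orth_proj_sum E_complete S_closed x).
  by rewrite [subval t]/(subval (orth_proj S x) + subval (u r)) opprD addrACA subrr add0r.
(* [b x_o = P f x_o] and [a u r = P u u P r = P P r], so both terms factor through [P]. *)
have hS (s : lin_subspace S) :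
    rd (B (x - subval t)) (subval s) = rd (f (xo x) - P r) (P s).
  rewrite xt (linB B_linear) !rdDl !rdNl -(rd_block (xo x)) -(rd_block (u r)).
  by rewrite -PuP -(uP r) uuP -Pf !P_symmetric.
have hS' (s : lin_subspace S) :
    `|rd (B (x - subval t)) (subval s)| <= e * nm (P s).
  rewrite hS; apply: le_trans (rd_cs_norm _ _) _.
  by rewrite ler_wpM2r ?nm_ge0// ltW.
exists t; split=> // [|y].
  rewrite /t (linD P_linear); apply: le_trans (nmD _ _) _; rewrite lerD2l -uP.
  apply: le_trans (hK _) _; rewrite ler_pM2l//.
  by have := nmBD (P r) (f (xo x)) 0; rewrite !subr0 (nmB (P r)); lra.
(* The [c] block cancels, and [<B (u r), y_o> = <u r, P f y_o> = <u P r, f y_o>]. *)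
have h1 : rd (B (x - subval t)) (subval (xo y)) - rd (schur_complement S B x) y =
    rd (u (f (xo x) - P r)) (f (xo y)).
  rewrite schE xt (linB B_linear) (linB lu) !rdDl !rdNl.
  rewrite [rd (B (subval (u r))) _]B_symmetric [rd (subval (u r)) _]rdC.
  rewrite -[rd (B _) (subval (u r))]rd_block -Pf P_symmetric -uP [rd (f (xo y)) _]rdC.
  lra.
have h2 : `|rd (u (f (xo x) - P r)) (f (xo y))| <= e * (K * nm (f (xo y))).
  apply: le_trans (rd_cs_norm _ _) _; rewrite mulrA ler_wpM2r ?nm_ge0//.
  by apply: le_trans (hK _) _; rewrite mulrC ler_pM2r// ltW.
have -> : rd (B (x - subval t)) y - rd (schur_complement S B x) y =
    rd (B (x - subval t)) (subval (orth_proj S y)) + rd (u (f (xo x) - P r)) (f (xo y)).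
  rewrite -h1 addrA -rdDr; congr (rd _ _ - _).
  exact: orth_proj_sum.
apply: le_trans (ler_normD _ _) _; rewrite mulrDr addrC lerD//.
Qed.

End Bound.

End Schur.

(** * Krein spaces *)

Lemma hilbert_nm_complete (R : realType) (E : innerType R) :
  (forall F : set_system E, ProperFilter F -> cauchy F -> cvg F) -> nm_complete E.
Proof.
move=> cE u cu.
have /cE : cauchy (u @ \oo).
  apply/cauchy_ballP => e e0.
  have eE : e = (complex.Re e)%:C by rewrite RRe_real// ger0_real// ltW.
  have [|N hN] := cu (complex.Re e); first by rewrite -ltcR -eE.
  exists (u @` [set n | (N <= n)%N], u @` [set n | (N <= n)%N]) => /=.
    by split; exists N => // n Nn; exists n.
  move=> [_ _] /= [[m Nm <-] [n Nn <-]].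
  by rewrite -ball_normE /= norm_nm eE ltcR; exact: hN.
move=> /(_ _) h; exists (lim (u @ \oo)) => e e0.
have := h (ball (lim (u @ \oo)) e%:C).
case; first by apply: nbhsx_ballx; rewrite -[0]/(0%:C) ltcR.
move=> N _ hN; exists N => n /hN /=.
by rewrite -ball_normE /= norm_nm ltcR nmB.
Qed.

Section KreinSpace.
Variables (R : realType) (H : lmodType R[i]).
Variable form : {hermitian H for false & (@conjC R[i])}.

Lemma submodN (A : submodClosed H) x : x \in A -> - x \in A.
Proof. by move=> xA; rewrite -scaleN1r rpredZ. Qed.

Lemma submodB (A : submodClosed H) x y : x \in A -> y \in A -> x - y \in A.
Proof. by move=> xA yA; rewrite rpredD// submodN. Qed.

Lemma proj_alongE (A B : submodClosed H) (x y : H) :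
    (forall z, z \in A -> z \in B -> z = 0) ->
  x \in A -> y \in B -> proj_along A B (x + y) = x.
Proof.
move=> AB0 xA yB; apply: xget_unique => [|q [/= qA qB]].
  by rewrite /= addrAC subrr add0r.
apply/eqP; rewrite -subr_eq0; apply/eqP/AB0; first exact: submodB.
by have := submodB yB qB; rewrite opprB addrCA [x + y]addrC opprD addNKr.
Qed.

Lemma form_conj x y : form x y = conjC (form y x).
Proof. by rewrite hermC expr0 mul1r. Qed.

Section Decomposition.
Variable D : fundamental_decomposition form.
Local Notation J := (signature_operator D).

Lemma fd_split x : exists p n, [/\ p \in fd_pos D, n \in fd_neg D & x = p + n].
Proof.
have [p pP nN] := fd_sum D x; exists p, (x - p).
by split=> //; rewrite addrC subrK.
Qed.

Lemma signatureE p n : p \in fd_pos D -> n \in fd_neg D -> J (p + n) = p - n.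
Proof.
move=> pP nN; congr (_ - _).
  by apply: proj_alongE => //; exact: fd_direct.
rewrite addrC; apply: proj_alongE => // z zN zP; exact: fd_direct zP zN.
Qed.

Lemma signatureK x : J (J x) = x.
Proof.
have [p [n [pP nN ->]]] := fd_split x.
by rewrite !signatureE ?submodN// opprK.
Qed.

Lemma signature_linear : linear J.
Proof.
move=> a x y; have [p [n [pP nN ->]]] := fd_split x.
have [q [m [qP mN ->]]] := fd_split y.
rewrite scalerDr addrACA !signatureE ?rpredD ?rpredZ//.
by rewrite scalerBr opprD addrACA.
Qed.

Lemma rd_signature (x y : hilbert_of D) : rd x y = complex.Re (form (J x) y).
Proof. by []. Qed.

Lemma rd_signatureJ (x y : hilbert_of D) :
  rd (J x : hilbert_of D) y = complex.Re (form x y).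
Proof. by rewrite rd_signature signatureK. Qed.

Lemma nm_signature (x : hilbert_of D) : nm (J x : hilbert_of D) = nm x.
Proof.
rewrite /nm; congr Num.sqrt; rewrite rd_signatureJ [RHS]rd_signature.
by rewrite form_conj complexRe_conj.
Qed.

Lemma rd_split p n : p \in fd_pos D -> n \in fd_neg D ->
  rd (p + n : hilbert_of D) (p + n) =
  complex.Re (form p p) - complex.Re (form n n).
Proof.
move=> pP nN; rewrite rd_signature signatureE// linearBl !linearDr /=.
rewrite (fd_orth pP nN) [form n p]form_conj (fd_orth pP nN) rmorph0 addr0 add0r.
by rewrite raddfB.
Qed.

(** [g] will be [form] on the positive part and [- form] on the negative part. *)
Lemma is_hilbert_complete (A : submodClosed H) (g : H -> H -> R[i]) :
    is_hilbert (fun x y : lin_subspace A => g (subval x) (subval y)) ->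
  forall u : nat -> lin_subspace A,
    (forall e, 0 < e -> exists N, forall m n, (N <= m)%N -> (N <= n)%N ->
      complex.Re (g (subval (u m - u n)) (subval (u m - u n))) < e ^+ 2) ->
  exists l : lin_subspace A, forall e, 0 < e -> exists N, forall n, (N <= n)%N ->
    complex.Re (g (subval (u n - l)) (subval (u n - l))) < e ^+ 2.
Proof.
move=> [ip [ipE cip _]] u cu.
have nmE (x : inner_of ip) : nm x ^+ 2 = complex.Re (g (subval x) (subval x)).
  by rewrite nm_sqr ipE.
have lt e (x : inner_of ip) : 0 < e ->
    (complex.Re (g (subval x) (subval x)) < e ^+ 2) = (nm x < e).
  by move=> e0; rewrite -nmE ltr_pXn2r// nnegrE ?nm_ge0 ?ltW.
have [|l hl] := @hilbert_nm_complete _ (inner_of ip) cip u.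
  move=> e e0; have [N hN] := cu e e0; exists N => m n Nm Nn.
  by rewrite -lt//; exact: hN.
exists l => e e0; have [N hN] := hl e e0; exists N => n Nn.
by rewrite (lt _ (u n - l))//; exact: hN.
Qed.

(** [nm (p + n) ^+ 2 = [p, p] - [n, n]], so the components of a Cauchy sequence are Cauchy in the
    two Hilbert spaces of [D]. *)
Lemma hilbert_of_complete : nm_complete (hilbert_of D).
Proof.
move=> u cu.
have sp n : exists pn : lin_subspace (fd_pos D) * lin_subspace (fd_neg D),
    u n = subval pn.1 + subval pn.2.
  have [p [m [pP mN ->]]] := fd_split (u n).
  by exists (Subspace pP, Subspace mN).
have [v hv] := choice sp.
have pos (x : lin_subspace (fd_pos D)) : 0 <= complex.Re (form (subval x) (subval x)).
  have := rd_split (valP x) (rpred0 (fd_neg D)).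
  by rewrite linear0l subr0 => <-; exact: rd_ge0.
have neg (x : lin_subspace (fd_neg D)) : 0 <= complex.Re (- form (subval x) (subval x)).
  have := rd_split (rpred0 (fd_pos D)) (valP x).
  by rewrite linear0l sub0r raddfN => <-; exact: rd_ge0.
have nm2 (p : lin_subspace (fd_pos D)) (n : lin_subspace (fd_neg D)) :
    nm (subval p + subval n : hilbert_of D) ^+ 2 =
    complex.Re (form (subval p) (subval p)) + complex.Re (- form (subval n) (subval n)).
  by rewrite nm_sqr (rd_split (valP p) (valP n)) raddfN.
have uB m n : u m - u n = subval ((v m).1 - (v n).1) + subval ((v m).2 - (v n).2).
  by rewrite !hv opprD addrACA.
have [|p hp] := is_hilbert_complete (g := form) (fd_pos_hilbert D) (u := fun n => (v n).1).
  move=> e e0; have [N hN] := cu e e0; exists N => m n Nm Nn.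
  apply: le_lt_trans (_ : nm (u m - u n : hilbert_of D) ^+ 2 < _).
    by rewrite uB nm2 lerDl.
  by rewrite ltr_pXn2r ?nnegrE ?nm_ge0 ?(ltW e0)//; exact: hN.
have [|q hq] := is_hilbert_complete (g := fun x y => - form x y) (fd_neg_hilbert D)
  (u := fun n => (v n).2).
  move=> e e0; have [N hN] := cu e e0; exists N => m n Nm Nn.
  apply: le_lt_trans (_ : nm (u m - u n : hilbert_of D) ^+ 2 < _).
    by rewrite uB nm2 lerDr.
  by rewrite ltr_pXn2r ?nnegrE ?nm_ge0 ?(ltW e0)//; exact: hN.
exists (subval p + subval q) => e e0.
have [|N hN] := hp (e / 2); first by rewrite divr_gt0.
have [|N' hN'] := hq (e / 2); first by rewrite divr_gt0.
exists (maxn N N') => n; rewrite geq_max => /andP[/hN h1 /hN' h2].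
rewrite -(@ltr_pXn2r _ 2) ?nnegrE ?nm_ge0 ?(ltW e0)//.
rewrite (_ : u n - _ = subval ((v n).1 - p) + subval ((v n).2 - q)); last first.
  by rewrite hv opprD addrACA.
rewrite nm2; apply: lt_trans (ltrD h1 h2) _.
by have := exprn_gt0 2 e0; rewrite expr_div_n; lra.
Qed.

End Decomposition.
End KreinSpace.

(** * Comparison of the Schur complements of two fundamental decompositions *)

Section KreinSchurComplement.
Variables (R : realType) (H : lmodType R[i]).
Variable form : {hermitian H for false & (@conjC R[i])}.
Implicit Types D : fundamental_decomposition form.

(* The vectors [J_D y] with [y] in the unit ball of [D'] are pointwise bounded
   functionals, since [<x, J_D y>_D = [x, y] = <J_D' x, y>_D']. *)
Lemma signature_norm_le D D' : exists2 C, 0 < C &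
  forall x, nm (x : hilbert_of D) <= C * nm (x : hilbert_of D').
Proof.
pose V : set (hilbert_of D) :=
  [set signature_operator D y | y in [set y | nm (y : hilbert_of D') <= 1]].
have [x|C hC] := @uniform_boundedness _ _ V (@hilbert_of_complete _ _ _ D).
  exists (nm (signature_operator D' x : hilbert_of D')) => _ [y y1 <-].
  rewrite rdC rd_signatureJ form_conj complexRe_conj -(@rd_signatureJ _ _ _ D').
  apply: le_trans (rd_cs _ _) _; rewrite ler_piMr ?nm_ge0//.
exists (`|C| + 1); first by rewrite ltr_wpDl.
apply: (@le_of_unit_ball _ H (fun x => nm (x : hilbert_of D))).
- by move=> r x; exact: (@nmZ _ (hilbert_of D)).
- by move=> r x; exact: (@nmZ _ (hilbert_of D')).
- by move=> x; exact: nm_ge0.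
- move=> x x1; rewrite -nm_signature; apply: le_trans (hC _ _) _; first by exists x.
  by rewrite (le_trans (ler_norm _))// lerDl.
Qed.

Variables (W : H -> H) (S : submodClosed H).
Hypothesis W_bounded : krein_bounded form W.
Hypothesis W_selfadjoint : krein_selfadjoint form W.
Hypothesis S_closed : krein_closed form S.

Definition krein_form x y : R := complex.Re (form (W x) y).

Lemma krein_formC x y : krein_form x y = krein_form y x.
Proof. by rewrite /krein_form W_selfadjoint form_conj complexRe_conj. Qed.

Definition gram D : hilbert_of D -> hilbert_of D := signature_operator D \o W.
Arguments gram : clear implicits.

Lemma rd_gram D (x y : hilbert_of D) : rd (gram D x) y = krein_form x y.
Proof. exact: rd_signatureJ. Qed.

Lemma gram_linear D : linear (gram D).
Proof.
have [/= lW _] := W_bounded D.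
by move=> a x y; rewrite /gram /= lW signature_linear.
Qed.

Lemma gram_bounded D : nm_bounded (gram D).
Proof.
have /bounded_operatorE[_ [M hM]] := W_bounded D.
by exists M => x; rewrite /gram nm_signature; exact: hM.
Qed.

Lemma gram_symmetric D : symmetric_op (gram D).
Proof. by move=> x y; rewrite [RHS]rdC !rd_gram krein_formC. Qed.

Lemma hilbert_closed D : @nm_closed R (hilbert_of D) S.
Proof. exact: closed_nm_closed (@S_closed D). Qed.

Definition gram_block D := @block R (hilbert_of D) S S (gram D).
Arguments gram_block : clear implicits.

Let sub_complete D : nm_complete (@lin_subspace R (hilbert_of D) S).
Proof.
exact: (lin_subspace_complete (@hilbert_of_complete _ _ _ D) (@hilbert_closed D)).
Qed.

Let gram_block_linear D : linear (gram_block D).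
Proof.
exact: (block_linear (@hilbert_of_complete _ _ _ D) (@hilbert_closed D) (@gram_linear D)).
Qed.

Let gram_block_bounded D : nm_bounded (gram_block D).
Proof.
exact: (block_bounded (@hilbert_of_complete _ _ _ D) (@hilbert_closed D) (@gram_bounded D)).
Qed.

Let gram_block_symmetric D : symmetric_op (gram_block D).
Proof.
exact: (block_symmetric (@hilbert_of_complete _ _ _ D) (@hilbert_closed D) (@gram_symmetric D)).
Qed.

Let rd_gram_block D (s t : @lin_subspace R (hilbert_of D) S) :
  rd (gram_block D s) t = krein_form (subval s) (subval t).
Proof.
rewrite (rd_block (gram D) (@hilbert_of_complete _ _ _ D) (@hilbert_closed D)).
exact: rd_gram.
Qed.

(** The seminorm [p_J], extended from [S] by the orthogonal projection so that all decompositions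
    share the domain [H]. *)
Definition majorant D x : R :=
  nm (sqrt_operator (abs_operator (gram_block D)) (@orth_proj R (hilbert_of D) S x)).
Arguments majorant : clear implicits.

Lemma majorantE D (s : @lin_subspace R (hilbert_of D) S) :
  majorant D (subval s) = nm (sqrt_operator (abs_operator (gram_block D)) s).
Proof.
by rewrite /majorant (orth_proj_id (@hilbert_of_complete _ _ _ D) (@hilbert_closed D)).
Qed.

(** The identity of [S], read between two Hilbert structures; it plays the part of [j] in
    [form_comparison]. *)
Definition transfer D D' (s : @lin_subspace R (hilbert_of D) S) :
    @lin_subspace R (hilbert_of D') S :=
  @Subspace R (hilbert_of D') S (subval s) (valP s).

(** The square of the majorant is [<|a| s, s>], so [form_comparison] applies to the two absolute
    values. Their norms compare because both compressions represent [krein_form] on [S]. *)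
Lemma majorant_le D D' : exists2 C, 0 < C &
  forall x, x \in S -> majorant D' x <= C * majorant D x.
Proof.
have [k k0 hk] := signature_norm_le D' D.
have [k' k'0 hk'] := signature_norm_le D D'.
have absP D0 : positive_operator (abs_operator (gram_block D0)).
  exact: (abs_positive (@sub_complete D0) (@gram_block_linear D0)
    (@gram_block_bounded D0) (@gram_block_symmetric D0)).
have [lA bA sA pA] := (positive_operatorE _).1 (absP D).
have [lB bB sB pB] := (positive_operatorE _).1 (absP D').
have [MA MA0 hMA] := nm_boundedP bA; have [MB MB0 hMB] := nm_boundedP bB.
have BA (s : @lin_subspace R (hilbert_of D) S) :
    nm (abs_operator (gram_block D') (transfer D' s)) <= k' * nm (abs_operator (gram_block D) s).
  rewrite (nm_abs (@sub_complete D') (@gram_block_linear D')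
    (@gram_block_bounded D') (@gram_block_symmetric D')).
  rewrite (nm_abs (@sub_complete D) (@gram_block_linear D)
    (@gram_block_bounded D) (@gram_block_symmetric D)).
  (* [nm z ^+ 2 = krein_form s z = <a s, z>] in [D], and [hk'] returns the norm of [z] to [D']. *)
  set z := gram_block D' (transfer D' s).
  apply: nm_le_rd; first by rewrite mulr_ge0 ?nm_ge0 ?ltW.
  rewrite {1}/z rd_gram_block -[krein_form _ _]/(krein_form (subval s) (subval (transfer D z))).
  rewrite -rd_gram_block; apply: le_trans (rd_cs _ _) _.
  rewrite mulrAC mulrC ler_wpM2r ?nm_ge0//; exact: hk'.
have lT : linear (@transfer D D') by move=> c s t; exact: val_inj.
have hT s : nm (@transfer D D' s) <= k * nm s by exact: hk.
have h := form_comparison lT lA lB sA sB pA k0 k'0 hT hMA hMB BA.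
(* The comparison is between squares, and [k' k <= (k' k + 1)^2] avoids a square root. *)
exists (k' * k + 1); first by rewrite ltr_wpDl ?mulr_ge0 ?ltW.
move=> x xS; rewrite -[x]/(subval (@Subspace R (hilbert_of D) S x xS)).
set s := @Subspace R (hilbert_of D) S x xS.
rewrite (@majorantE D s) -[subval s]/(subval (@transfer D D' s)) (@majorantE D').
rewrite -(@ler_pXn2r _ 2) ?nnegrE ?mulr_ge0 ?nm_ge0 ?addr_ge0 ?mulr_ge0 ?(ltW k0) ?(ltW k'0)//.
rewrite exprMn (nm_sqrt_operator (@sub_complete D') (absP D')).
rewrite (nm_sqrt_operator (@sub_complete D) (absP D)).
apply: le_trans (h s) _; rewrite ler_wpM2r ?pA//.
have kk : 0 < k' * k by exact: mulr_gt0.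
by rewrite sqrrD expr1n; have := sqr_ge0 (k' * k); lra.
Qed.

Hypothesis W_complementable : krein_weakly_complementable form W S.

(** Weak complementability gives the bound for one decomposition [D0]; equivalence of the norms and
    of the majorants carries it to every [D]. *)
Lemma gram_le_majorant D : exists2 C, 0 <= C &
  forall x, x \in S -> nm (gram D x) <= C * majorant D x.
Proof.
have [D0 wc] := W_complementable.
have [C C0 hC] := weakly_complementable_bound (@hilbert_of_complete _ _ _ D0)
  (@hilbert_closed D0) (@gram_linear D0) (@gram_bounded D0) (@gram_symmetric D0) wc.
have [k k0 hk] := signature_norm_le D0 D.
have [c c0 hc] := majorant_le D D0.
exists (k * (C * c)); first by rewrite !mulr_ge0 ?(ltW k0) ?(ltW c0).
move=> x xS; apply: le_trans (_ : k * nm (gram D0 x) <= _).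
  apply: nm_le_rd; first by rewrite mulr_ge0 ?nm_ge0 ?ltW.
  rewrite rd_gram -(@rd_gram D0); apply: le_trans (rd_cs _ _) _.
  by rewrite mulrAC mulrC ler_wpM2r ?nm_ge0//; exact: hk.
rewrite -!mulrA ler_pM2l//; have h := hC (@Subspace R (hilbert_of D0) S x xS).
rewrite -(@majorantE D0) in h; apply: le_trans h _.
by rewrite ler_wpM2l//; exact: hc.
Qed.

(** [schur_approx] freed of [D]-inner products: the leading [J] of the Krein Schur complement turns
    [<., y>] into [form]. *)
Lemma krein_schur_approx D : exists q : H -> R, (forall y, 0 <= q y) /\
  forall x, exists M, forall e, 0 < e -> e <= 1 -> exists t,
    [/\ t \in S, majorant D t <= M,
      forall s, s \in S -> `|krein_form (x - t) s| <= e * majorant D s &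
      forall y, `|krein_form (x - t) y -
                  complex.Re (form (krein_schur_complement W S D x) y)| <= e * q y].
Proof.
have [C C0 hC] := gram_le_majorant D.
have hC' (s : @lin_subspace R (hilbert_of D) S) : nm (gram D (subval s)) <=
    C * nm (sqrt_operator (abs_operator (gram_block D)) s).
  by rewrite -majorantE; apply: hC; exact: valP.
have [q [q0 hq]] := schur_approx (@hilbert_of_complete _ _ _ D) (@hilbert_closed D)
  (@gram_linear D) (@gram_bounded D) (@gram_symmetric D) C0 hC'.
exists q; split=> // x; have [M hM] := hq x; exists M => e e0 e1.
have [t [tM ts ty]] := hM e e0 e1; exists (subval t); split.
- exact: valP.
- by rewrite majorantE.
- move=> s sS; have := ts (@Subspace R (hilbert_of D) S s sS).
  by rewrite rd_gram -(@majorantE D).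
- move=> y; have := ty y; rewrite rd_gram.
  by rewrite /krein_schur_complement /= -rd_signature.
Qed.

Lemma krein_schur_cross D D' x y :
  complex.Re (form (krein_schur_complement W S D x) y) =
  complex.Re (form (krein_schur_complement W S D' y) x).
Proof.
have [q [q0 hq]] := krein_schur_approx D; have [q' [q'0 hq']] := krein_schur_approx D'.
have [M hM] := hq x; have [M' hM'] := hq' y.
have [c c0 hc] := majorant_le D D'; have [c' c'0 hc'] := majorant_le D' D.
set L := complex.Re _; set L' := complex.Re _.
apply/eqP; rewrite -subr_eq0 -normr_eq0; apply/eqP.
apply: (@small_eq0 _ _ (q y + c' * M' + (q' x + c * M))); first exact: normr_ge0.
(* The approximations are available only for [e <= 1]. *)
move=> e0 e0_gt0; pose e := Num.min e0 1.
have e_gt0 : 0 < e by rewrite lt_min e0_gt0 ltr01.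
have e_le1 : e <= 1 by rewrite ge_min lexx orbT.
have e_le : e <= e0 by rewrite ge_min lexx.
have [t [tS tM ts ty]] := hM e e_gt0 e_le1.
have [t' [t'S t'M t's t'y]] := hM' e e_gt0 e_le1.
have lW : linear W by have [] := W_bounded D.
have wB a b c1 : krein_form a (b - c1) = krein_form a b - krein_form a c1.
  by rewrite /krein_form linearBr raddfB.
(* [krein_form (x - t) y] is close to [L], and the term in [t'] is small because [t'] lies in [S]
   with a [D]-majorant at most [c' * M']. *)
have h1 : `|krein_form (x - t) (y - t') - L| <= e * (q y + c' * M').
  rewrite wB addrAC mulrDr; apply: le_trans (ler_normB _ _) _.
  apply: lerD; first exact: ty.
  apply: le_trans (ts _ t'S) _; rewrite ler_pM2l//.
  by apply: le_trans (hc' _ t'S) _; rewrite ler_pM2l.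
have h2 : `|krein_form (x - t) (y - t') - L'| <= e * (q' x + c * M).
  rewrite krein_formC wB addrAC mulrDr; apply: le_trans (ler_normB _ _) _.
  apply: lerD; first exact: t'y.
  apply: le_trans (t's _ tS) _; rewrite ler_pM2l//.
  by apply: le_trans (hc _ tS) _; rewrite ler_pM2l.
set K := q y + c' * M' + _.
have K0 : `|L - L'| <= e * K.
  have -> : L - L' = (krein_form (x - t) (y - t') - L') - (krein_form (x - t) (y - t') - L) by ring.
  by apply: le_trans (ler_normB _ _) _; rewrite /K mulrDr addrC lerD.
have K_ge0 : 0 <= K by rewrite -(pmulr_rge0 _ e_gt0); exact: le_trans (normr_ge0 _) K0.
by apply: le_trans K0 _; rewrite mulrC ler_wpM2l.
Qed.

End KreinSchurComplement.

Unset Implicit Arguments.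

Theorem theorem4p5 (R : realType) (H : lmodType R[i])
  (form : {hermitian H for false & (@Num.Def.conjC R[i])})
  (H_krein : is_krein form)
  (W : H -> H) (W_bounded : krein_bounded form W)
  (W_selfadjoint : krein_selfadjoint form W)
  (S : submodClosed H) (S_closed : krein_closed form S)
  (W_compl : krein_weakly_complementable form W S)
  (D : fundamental_decomposition form)
  (D_alpha : fundamental_decomposition form) :
  krein_schur_complement W S D = krein_schur_complement W S D_alpha.
Proof.
apply/funext => x.
rewrite -[LHS](signatureK D) -[RHS](signatureK D); congr signature_operator.
apply: (@rd_ext R (hilbert_of D)) => y; rewrite !rd_signatureJ.
have cross := krein_schur_cross W_bounded W_selfadjoint S_closed W_compl.
(* The first use swaps [x] and [y]; the second, with [D_alpha] on both sides, swaps them back. *)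
by rewrite (cross D D_alpha) -(cross D_alpha D_alpha).
Qed.
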